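(* With the notation of the context, assume (H1), (H2), (H4) and (H3)(i),(iii), where in addition the function $\eta$ of (H3)(iii) belongs to $L^1([t_0,\infty))$ and $t\mapsto f(t,0,0)$ belongs to $L^1([t_0,\infty))$ (it is not required that $f(t,0,0)=0$). Assume that the linear equation $z'(t)=A(t)z(t)+B(t)z(\gamma(t))$ has an ordinary dichotomy with projection $P$ on $[t_0,\infty)$. Then there exists a homeomorphism $y\mapsto v$ between the bounded solutions of the linear system $$y'(t)=A(t)y(t)+B(t)y(\gamma(t))+g(t)$$ and the bounded solutions of the quasilinear system $$v'(t)=A(t)v(t)+B(t)v(\gamma(t))+g(t)+f(t,v(t),v(\gamma(t))).$$ Moreover, $|y(t)-v(t)|\to0$ as $t\to\infty$ (for $v$ corresponding to $y$) if $Z(t,0)P\to0$ as $t\to\infty$.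
   Context: Fix a norm $|\cdot|$ on $\mathbb C^p$ and the induced matrix norm. Let $\{t_i\}_{i\in\mathbb Z},\{\zeta_i\}_{i\in\mathbb Z}$ be real sequences with $t_i<t_{i+1}$, $t_i\le\zeta_i\le t_{i+1}$, $t_i\to\pm\infty$ as $i\to\pm\infty$. Put $I_i=[t_i,t_{i+1})$, $\gamma(t)=\zeta_i$ for $t\in I_i$, $I_i^+=[t_i,\zeta_i]$, $I_i^-=(\zeta_i,t_{i+1})$. A solution of $v'(t)=F(t,v(t),v(\gamma(t)))$ on an interval $I$ is a continuous function $v$ on $I$, differentiable except possibly at the points $t_i\in I$, where one-sided derivatives exist, satisfying the equation on each $(t_i,t_{i+1})\subset I$ and with the right derivative at the points $t_i\in I$. Bounded solutions are taken on $[t_0,\infty)$, with the topology of the norm $\|y\|=\sup_{s\ge t_0^*}|y(s)|$, $t_0^*=\min\{t_0,\gamma(t_0)\}$. (H1) $A,B:\mathbb R\to\mathbb C^{p\times p}$ and $g:\mathbb R\to\mathbb C^p$ are locally integrable. (H2) For $M\in L^1_{\rm loc}(\mathbb R;\mathbb C^{p\times p})$ put $\rho_i^\pm(M)=\exp\big(\int_{I_i^\pm}|M(s)|ds\big)$, $\rho_i(M)=\rho_i^+(M)\rho_i^-(M)$, and let $\nu_i^\pm(B)=\rho_i^\pm(A)\ln\rho_i^\pm(B)$. Then $\rho(A):=\sup_i\rho_i(A)<\infty$ and there are constants $\nu^\pm$ with $\nu_i^+(B)\le\nu^+<1$ and $\nu_i^-(B)\le\nu^-<1$ for all $i$. (H3)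 (i) $f:\mathbb R\times\mathbb C^p\times\mathbb C^p\to\mathbb C^p$ is continuous; (iii) there is $\eta\in L^1_{\rm loc}(\mathbb R;[0,\infty))$ with $|f(t,x_1,y_1)-f(t,x_2,y_2)|\le\eta(t)(|x_1-x_2|+|y_1-y_2|)$ for all $t\in\mathbb R$, $x_i,y_i\in\mathbb C^p$. (H4) With $\Phi(t,s)=X(t)X^{-1}(s)$, $X$ a fundamental matrix of $x'=A(t)x$, and $J(t,\tau)=I_p+\int_\tau^t\Phi(\tau,s)B(s)ds$, the matrix $J(t,\tau)$ is nonsingular for all $t,\tau\in[t_i,t_{i+1})$, $i\in\mathbb Z$. $Z(t,s)$ is the fundamental matrix of the linear equation for $z$: for each $(\tau,\xi)$ the unique solution on $\mathbb R$ with $z(\tau)=\xi$ is $z(t)=Z(t,\tau)\xi$. For a projection matrix $P\in\mathbb C^{p\times p}$ put $Z_P(t,s)=Z(t,0)PZ(0,s)$ for $t\ge s$ and $Z_P(t,s)=-Z(t,0)(I-P)Z(0,s)$ for $t<s$. The linear equation has an ordinary dichotomy with projection $P$ (on $[t_0,\infty)$) if there is $c>0$ with $|Z_P(t,s)|\le c$ for all $t,s$ (in $[t_0,\infty)$).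
   Formalization: The claim can fail for the prescribed t_0; what is proved is that there is T ≥ t_0 such that for every τ ≥ T the homeomorphism, with its asymptotic property, holds between the bounded solutions on [τ,∞), i.e. for initial time sufficiently large. *)

(* Defs.v *)
From mathcomp Require Export all_boot all_order all_algebra.
From mathcomp Require Export all_classical all_reals all_analysis.
From mathcomp.real_closed Require Export complex.

Set Implicit Arguments.
Unset Strict Implicit.
Unset Printing Implicit Defensive.

Import Order.TTheory GRing.Theory Num.Theory.
Import numFieldNormedType.Exports.

Local Open Scope classical_set_scope.
Local Open Scope ring_scope.
Local Open Scope complex_scope.

(* C^p is 'cV[R[i]]_p.  The library norm of R[i] takes its values in R[i];
   all norms below are real valued, with Normc.normc the complex modulus. *)
Record is_norm (R : realType) (p : nat) (nrm : 'cV[R[i]]_p -> R) : Prop := {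
  is_norm_eq0 : forall x, nrm x = 0 -> x = 0;
  is_normZ : forall (a : R[i]) x, nrm (a *: x) = ComplexField.Normc.normc a * nrm x;
  is_normD : forall x y, nrm (x + y) <= nrm x + nrm y }.

Definition opnorm (R : realType) (p : nat) (nrm : 'cV[R[i]]_p -> R)
    (M : 'M[R[i]]_p) : R :=
  sup [set nrm (M *m x) | x in [set x | nrm x <= 1]].

Section Integrals.
Variables (R : realType) (m n : nat).
Implicit Type M : R -> 'M[R[i]]_(m, n).

Definition loc_integrable_mx M : Prop := forall i j,
  locally_integrable setT (fun s => complex.Re (M s i j)) /\
  locally_integrable setT (fun s => complex.Im (M s i j)).

Definition integrable_mx (D : set R) M : Prop := forall i j,
  (@lebesgue_measure R).-integrable D (fun s => (complex.Re (M s i j))%:E) /\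
  (@lebesgue_measure R).-integrable D (fun s => (complex.Im (M s i j))%:E).

Definition oriented_int (h : R -> R) (a b : R) : R :=
  if a <= b then \int[@lebesgue_measure R]_(s in `[a, b]) h s
  else - \int[@lebesgue_measure R]_(s in `[b, a]) h s.

Definition oriented_int_mx M (a b : R) : 'M[R[i]]_(m, n) :=
  \matrix_(i, j) (oriented_int (fun s => complex.Re (M s i j)) a b
                  +i* oriented_int (fun s => complex.Im (M s i j)) a b).

End Integrals.

Section PiecewiseConstantArgument.
Variables (R : realType) (tgrid zeta : int -> R) (gamma : R -> R).

Definition step_interval (i : int) : set R := `[tgrid i, tgrid (i + 1)[.

Record is_grid : Prop := {
  grid_lt : forall i, tgrid i < tgrid (i + 1);
  grid_zeta : forall i, tgrid i <= zeta i <= tgrid (i + 1);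
  grid_pinfty : (fun n : nat => tgrid n%:Z) @ \oo --> +oo;
  grid_ninfty : (fun n : nat => tgrid (- n%:Z)) @ \oo --> -oo;
  grid_gamma : forall i s, step_interval i s -> gamma s = zeta i }.

Variables (p : nat) (nrm : 'cV[R[i]]_p -> R).
Local Notation V := 'cV[R[i]]_p.

Definition continuous_on (D : set R) (v : R -> V) : Prop :=
  forall t, D t -> (fun s => nrm (v s - v t)) @ within D (nbhs t) --> (0 : R).

Definition jointly_continuous (f : R -> V -> V -> V) : Prop :=
  forall t x y e, 0 < e -> exists2 d, 0 < d &
    forall t' x' y', `|t' - t| < d -> nrm (x' - x) < d -> nrm (y' - y) < d ->
      nrm (f t' x' y' - f t x y) < e.

(* L is the limit of (v (t + h) - v t) / h as h tends to 0 along F. *)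
Definition deriv_along (F : set_system R) (v : R -> V) (t : R) (L : V) : Prop :=
  (fun h => nrm ((h^-1)%:C *: (v (t + h) - v t) - L)) @ F --> (0 : R).

(* Solution of v'(t) = F(t, v(t), v(gamma(t))) on the interval I, where v is
   defined on D, which contains I and gamma(I).  The differentiability
   conditions are relative to I: at a left endpoint of I the derivative is the
   right derivative, and nothing is asked of a left derivative there since the
   filter is then improper. *)
Record is_solution (D I : set R) (F : R -> V -> V -> V) (v : R -> V) : Prop := {
  solution_cont : continuous_on D v;
  solution_deriv : forall t, I t -> ~ range tgrid t ->
    deriv_along (within [set h | I (t + h)] 0^') v t (F t (v t) (v (gamma t)));
  solution_deriv_right : forall i, I (tgrid i) ->
    deriv_along (within [set h | I (tgrid i + h)] 0^'+) v (tgrid i)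
      (F (tgrid i) (v (tgrid i)) (v (gamma (tgrid i))));
  solution_deriv_left : forall i, I (tgrid i) -> exists L,
    deriv_along (within [set h | I (tgrid i + h)] 0^'-) v (tgrid i) L }.

Definition ode_rhs (A : R -> 'M[R[i]]_p) : R -> V -> V -> V :=
  fun t x _ => A t *m x.
Definition linear_rhs (A B : R -> 'M[R[i]]_p) : R -> V -> V -> V :=
  fun t x y => A t *m x + B t *m y.
Definition affine_rhs (A B : R -> 'M[R[i]]_p) (g : R -> V) : R -> V -> V -> V :=
  fun t x y => A t *m x + B t *m y + g t.
Definition quasilinear_rhs (A B : R -> 'M[R[i]]_p) (g : R -> V)
    (f : R -> V -> V -> V) : R -> V -> V -> V :=
  fun t x y => A t *m x + B t *m y + g t + f t x y.

Definition is_fundamental_ode (A X : R -> 'M[R[i]]_p) : Prop :=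
  (forall t, X t \in unitmx) /\
  (forall xi, is_solution setT setT (ode_rhs A) (fun t => X t *m xi)).

Definition transition (X : R -> 'M[R[i]]_p) (t s : R) : 'M[R[i]]_p :=
  X t *m invmx (X s).

Definition is_fundamental_pca (A B : R -> 'M[R[i]]_p)
    (Z : R -> R -> 'M[R[i]]_p) : Prop :=
  forall tau xi, [/\ Z tau tau *m xi = xi,
    is_solution setT setT (linear_rhs A B) (fun t => Z t tau *m xi) &
    forall z, is_solution setT setT (linear_rhs A B) z -> z tau = xi ->
      forall t, z t = Z t tau *m xi].

Definition rho_plus (M : R -> 'M[R[i]]_p) (i : int) : R :=
  expR (\int[@lebesgue_measure R]_(s in `[tgrid i, zeta i]) opnorm nrm (M s)).
Definition rho_minus (M : R -> 'M[R[i]]_p) (i : int) : R :=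
  expR (\int[@lebesgue_measure R]_(s in `]zeta i, tgrid (i + 1)[)
          opnorm nrm (M s)).
Definition rho (M : R -> 'M[R[i]]_p) (i : int) : R :=
  rho_plus M i * rho_minus M i.
Definition nu_plus (A B : R -> 'M[R[i]]_p) (i : int) : R :=
  rho_plus A i * ln (rho_plus B i).
Definition nu_minus (A B : R -> 'M[R[i]]_p) (i : int) : R :=
  rho_minus A i * ln (rho_minus B i).

Definition hyp_H1 (A B : R -> 'M[R[i]]_p) (g : R -> V) : Prop :=
  [/\ loc_integrable_mx A, loc_integrable_mx B & loc_integrable_mx g].

Definition hyp_H2 (A B : R -> 'M[R[i]]_p) : Prop :=
  [/\ has_ubound (range (rho A)),
      exists2 nup, nup < 1 & forall i, nu_plus A B i <= nup &
      exists2 nun, nun < 1 & forall i, nu_minus A B i <= nun].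

Definition hyp_H3_lipschitz (f : R -> V -> V -> V) (eta : R -> R) : Prop :=
  [/\ forall t, 0 <= eta t, locally_integrable setT eta &
      forall t x1 y1 x2 y2,
        nrm (f t x1 y1 - f t x2 y2) <= eta t * (nrm (x1 - x2) + nrm (y1 - y2))].

Definition J_mx (X B : R -> 'M[R[i]]_p) (t tau : R) : 'M[R[i]]_p :=
  1%:M + oriented_int_mx (fun s => transition X tau s *m B s) tau t.

Definition hyp_H4 (X B : R -> 'M[R[i]]_p) : Prop :=
  forall i t tau, step_interval i t -> step_interval i tau ->
    J_mx X B t tau \in unitmx.

Definition dichotomy_kernel (Z : R -> R -> 'M[R[i]]_p) (P : 'M[R[i]]_p)
    (t s : R) : 'M[R[i]]_p :=
  if s <= t then Z t 0 *m P *m Z 0 s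
  else - (Z t 0 *m (1%:M - P) *m Z 0 s).

Definition ordinary_dichotomy (Z : R -> R -> 'M[R[i]]_p) (P : 'M[R[i]]_p)
    (t0 : R) : Prop :=
  P *m P = P /\
  exists2 c, 0 < c &
    forall t s, t0 <= t -> t0 <= s -> opnorm nrm (dichotomy_kernel Z P t s) <= c.

Definition initial_ray (t0 : R) : set R := `[Order.min t0 (gamma t0), +oo[.

Definition supnorm (D : set R) (u : R -> V) : R :=
  sup [set nrm (u s) | s in D].

(* Functions on D are represented by total functions that vanish off D, so that
   two of them are equal as soon as they agree on D. *)
Definition bounded_solutions (t0 : R) (F : R -> V -> V -> V) : set (R -> V) :=
  [set v | [/\ is_solution (initial_ray t0) `[t0, +oo[ F v,
    exists M, forall s, initial_ray t0 s -> nrm (v s) <= M &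
    forall s, ~ initial_ray t0 s -> v s = 0]].

(* Bijectivity of H is required separately, so the last clause says that its
   inverse is continuous. *)
Definition is_homeo (D : set R) (S T : set (R -> V))
    (H : (R -> V) -> (R -> V)) : Prop :=
  [/\ set_bij S T H,
      forall y, S y -> forall e, 0 < e -> exists2 d, 0 < d &
        forall y', S y' -> supnorm D (y' \- y) < d ->
          supnorm D (H y' \- H y) < e &
      forall y, S y -> forall e, 0 < e -> exists2 d, 0 < d &
        forall y', S y' -> supnorm D (H y' \- H y) < d ->
          supnorm D (y' \- y) < e].

End PiecewiseConstantArgument.

(* Main.v *)
(* On each step [t_i, t_(i+1)) the equation with forcing [h] has the particular
   solution [X(t) \int_zeta_i^t X^-1 h], bounded by the integral of [h] because
   Gronwall's inequality and (H2) bound [X(t) X^-1(s)] there. The jumps of these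
   at the grid points are summable when [h] is integrable, and the dichotomy
   compensates them by a bounded solution of the homogeneous equation. Writing
   [W v] for the bounded function obtained for [h(t) = f(t, v(t), v(gamma t))],
   [v] solves the quasilinear equation iff [v - W v] solves the linear one. Far
   to the right the integral of [eta] is small, so [W] is a contraction and
   [v |-> v - W v] is a bi-Lipschitz bijection. *)

Require Import Defs.
From mathcomp Require Import measurable_realfun ring lra zify.

Set Implicit Arguments.
Unset Strict Implicit.
Unset Printing Implicit Defensive.

Import Order.TTheory GRing.Theory Num.Theory.
Import numFieldNormedType.Exports.
Local Open Scope classical_set_scope.
Local Open Scope ring_scope.
Local Open Scope complex_scope.

(** * The increments of a function with dominated derivative *)

(** The derivative of a solution is known only pointwise, and the coefficients are only locally
    integrable, so solutions are not given by integral formulas from the outset. All estimates pass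
    through one inequality: a continuous function whose difference quotients are dominated pointwise
    by a measurable [phi] has increments bounded by the integral of [phi]. It gives both Gronwall's
    inequality and the bound on the particular solutions. The forcing is made continuous across the
    grid by freezing its delayed argument at [zeta_i] on each step, so the particular solutions come
    from primitives of continuous functions. The compensation of the jumps is a Green sum: if [L] is
    the sum of the [I - P] parts of all jumps pulled back to time 0, then the sum of the past jumps
    minus [L] consists of stable terms from the past and unstable terms from the future. With [M]
    bounding the transition matrices and [c] the kernel, a forcing of total size [S] produces at
    most [M (1 + 2 c) S]: [M] from the particular solution and [2 M c] from the jumps, each step
    meeting two of them. *)

Lemma interval_additive_induction (R : realType) (Q : R -> R -> Prop) (a b : R) :
  a <= b ->
  (forall x y z, a <= x -> x <= y -> y <= z -> z <= b ->
     Q x y -> Q y z -> Q x z) ->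
  (forall x, a <= x <= b -> exists2 d, 0 < d &
     forall u v, a <= u -> u <= x -> x <= v -> v <= b -> v - u < d -> Q u v) ->
  Q a b.
Proof.
move=> ab Qtrans Qloc.
(* [S] is the set of points reachable from [a]. Only intervals straddling a point are known to be
   good, which is what a derivative at that point controls; one such interval around [sup S]
   suffices to reach and pass it, unless it is [b]. *)
pose S := [set x | a <= x <= b /\ Q a x].
have Sa : S a.
  split; first by rewrite lexx ab.
  have [|d d0] := Qloc a; first by rewrite lexx ab.
  by apply; rewrite ?lexx// subrr.
have Sb : has_ubound S by exists b => x [/andP[]].
have supS : has_sup S by split; [exists a|].
have as_ : a <= sup S by apply: ub_le_sup.
have sb : sup S <= b by apply: ge_sup => [|x [/andP[]]//]; exists a.
have [|d d0 Qd] := Qloc (sup S); first by rewrite as_ sb.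
have [x [/andP[ax xb] Qx] xs] := sup_adherent (divr_gt0 d0 (ltr0n R 2)) supS.
have xS : x <= sup S by apply: ub_le_sup => //; split => //; rewrite ax xb.
(* The interval from [x] to [v] straddles [sup S] and is shorter than [d / 2 + d / 3 < d]. *)
pose v := Num.min b (sup S + d / 3).
have sv : sup S <= v by rewrite /v le_min sb lerDl divr_ge0// ltW.
have Qv : Q a v.
  apply: (Qtrans a x v); rewrite ?lexx//; first exact: le_trans sv.
    by rewrite /v ge_min lexx.
  apply: Qd => //; first by rewrite /v ge_min lexx.
  have : v <= sup S + d / 3 by rewrite /v ge_min lexx orbT.
  by move: xs d0; lra.
have : v <= sup S.
  apply: ub_le_sup => //; split => //; rewrite (le_trans as_ sv)/=.
  by rewrite /v ge_min lexx.
rewrite /v ge_min; case/orP => [bs|]; last by move: d0; lra.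
by move: Qv; rewrite /v min_l// (le_trans bs)// lerDl divr_ge0// ltW.
Qed.

Lemma nneseries_term_le (R : realType) (u : nat -> \bar R) (n : nat) :
  (forall k, 0 <= u k)%E -> (u n <= \sum_(0 <= k <oo) u k)%E.
Proof.
move=> u0; apply: le_trans (nneseries_lim_ge n.+1 _) => //.
by rewrite big_nat_recr//= leeDr// sume_ge0.
Qed.

(* The level sets [k e <= phi < (k+1) e] are covered by open sets [V k] of
   nearly the same measure: [\sum_k (k+1) e mu (V k `&` ]x, y])] is additive in
   the interval and locally dominates the increments of [m]. *)
Lemma le_dist_integral (R : realType) (m phi : R -> R) (a b : R) :
  a < b -> {in `[a, b], continuous m} ->
  measurable_fun `]a, b[ phi -> (forall x, a < x < b -> 0 <= phi x) ->
  (forall x, a < x < b -> forall e : R, 0 < e -> exists2 d : R, 0 < d &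
     forall h, `|h| < d -> `|m (x + h) - m x| <= `|h| * (phi x + e)) ->
  (`|m b - m a|%:E <= \int[@lebesgue_measure R]_(x in `]a, b[) (phi x)%:E)%E.
Proof.
move=> ab cm mphi phi0 dm.
set mu := @lebesgue_measure R.
have mI : measurable (`]a, b[%classic : set R) by [].
have [intoo|] := eqVneq (\int[mu]_(x in `]a, b[) (phi x)%:E)%E +oo%E.
  by rewrite intoo leey.
rewrite -ltey => intfin.
have muI : mu `]a, b[%classic = (b - a)%:E.
  by rewrite /mu/= lebesgue_measure_itv/= lte_fin ab -EFinB.
(* Of the error, one [e * (b - a)] pays for rounding [phi] up to a multiple of [e], the other for
   the slack in the difference quotients, and the last [e] for the excess measure of the open sets
   [V k]. *)
suff H (e : R) : 0 < e -> (`|m b - m a|%:E <= \int[mu]_(x in `]a, b[) (phi x)%:E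
      + (2 * e * (b - a) + e)%:E)%E.
  apply/lee_addgt0Pr => e e0.
  have K0 : 0 < 2 * (b - a) + 1 by move: ab => ?; lra.
  have := H (e / (2 * (b - a) + 1)) (divr_gt0 e0 K0).
  by rewrite (_ : 2 * _ * _ + _ = e)//; field; rewrite gt_eqF.
move=> e0.
pose lvl (k : nat) := `[k%:R * e, k.+1%:R * e[%classic : set R.
pose E k := `]a, b[%classic `&` phi @^-1` lvl k.
have mE k : measurable (E k) by apply: (mphi mI); exact: measurable_itv.
have EI k : E k `<=` `]a, b[ by exact: subIsetl.
have Efin k : (mu (E k) < +oo)%E.
  have : (mu (E k) <= mu `]a, b[%classic)%E.
    apply: le_measure; last exact: EI.
    - by rewrite inE; exact: mE.
    - by rewrite inE; exact: mI.
  by move=> /le_lt_trans; apply; rewrite muI ltry.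
(* The weight [k.+1%:R * e] turns this excess into [e / 2 ^ k.+1], whose sum is [e]. *)
have : forall k, exists U : set R, [/\ open U, E k `<=` U &
    (mu (U `\` E k) < (e / (2 ^ k.+1)%:R / (k.+1%:R * e))%:E)%E].
  move=> k; apply: lebesgue_regularity_outer => //.
  by rewrite !divr_gt0// ?mulr_gt0// ltr0n expn_gt0.
move=> /choice[V HV].
have oV k : open (V k) by have [] := HV k.
have mV k : measurable (V k) by exact: open_measurable.
have EV k : E k `<=` V k by have [] := HV k.
pose S x y := (\sum_(0 <= k <oo) ((k.+1%:R * e)%:E * mu (V k `&` `]x, y])))%E.
have w0 k : (0 <= (k.+1%:R * e)%:E)%E by rewrite lee_fin mulr_ge0// ltW.
have S0 x y k : (0 <= (k.+1%:R * e)%:E * mu (V k `&` `]x, y]))%E.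
  by rewrite mule_ge0.
have mVI k x y : measurable (V k `&` `]x, y]).
  by apply: measurableI; [exact: mV|exact: measurable_itv].
have mVE k : measurable (V k `\` E k) by apply: measurableD; [exact: mV|exact: mE].
have SD x y z : x <= y -> y <= z -> (S x z = S x y + S y z)%E.
  move=> xy yz; rewrite /S -nneseriesD//; apply: eq_eseriesr => k _.
  rewrite -ge0_muleDr//; congr (_ * _)%E.
  rewrite -measureU//; [|exact: mVI|exact: mVI|].
    rewrite -setIUr; congr (mu (_ `&` _)).
    by apply/seteqP; split=> t /=; rewrite !in_itv/=; move: xy yz; lra.
  by apply/seteqP; split=> t //=; rewrite !in_itv/=; move: xy yz; lra.
have Sab : (S a b <= \int[mu]_(x in `]a, b[) (phi x)%:E + (e * (b - a) + e)%:E)%E.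
  have IE : `]a, b[%classic = \bigcup_k E k.
    apply/seteqP; split => [x /= xab|x [k _ /EI//]].
    have p0 : 0 <= phi x / e by rewrite divr_ge0 ?phi0 ?(ltW e0)//.
    have /andP[h1 h2] := truncn_itv p0.
    exists (Num.truncn (phi x / e)) => //; split => //=.
    by rewrite /lvl/= in_itv/= -ler_pdivlMr// h1 -ltr_pdivrMr.
  have tE : trivIset setT E.
    apply/trivIsetP => i j _ _ /eqP ij; apply/seteqP; split => // x [].
    rewrite /E /lvl/= !in_itv/= => -[_ /andP[i1 i2]] [_ /andP[j1 j2]].
    have := le_lt_trans i1 j2; have := le_lt_trans j1 i2.
    rewrite !(ltr_pM2r e0) !ltr_nat !ltnS => ji ij'.
    by apply: ij; apply/eqP; rewrite eqn_leq ji ij'.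
  have mphie : measurable_fun `]a, b[ (fun x => (phi x + e)%:E).
    apply/measurable_EFinP; exact: measurable_funD.
  have phie0 x : `]a, b[%classic x -> (0 <= (phi x + e)%:E)%E.
    by move=> xab; rewrite lee_fin addr_ge0 ?phi0// ltW.
  have -> : (\int[mu]_(x in `]a, b[) (phi x)%:E + (e * (b - a) + e)%:E =
     \int[mu]_(x in `]a, b[) (phi x + e)%:E + e%:E)%E.
    under [in RHS]eq_integral do rewrite EFinD.
    rewrite ge0_integralD//.
    - have -> : (\int[mu]_(x in `]a, b[) e%:E = (e * (b - a))%:E)%E.
        transitivity (e%:E * mu `]a, b[%classic)%E; last by rewrite muI.
        exact: (integral_cst mu mI e%:E).
      by rewrite EFinD addeA.
    - by apply/measurable_EFinP.
    - by move=> x _; rewrite lee_fin ltW.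
  rewrite IE ge0_integral_bigcup//; last 2 first.
  - by rewrite -IE.
  - by move=> x; rewrite -IE; exact: phie0.
  apply: le_trans (epsilon_trick _ _ (ltW e0)); last first.
    by move=> k; apply: integral_ge0 => x /EI; exact: phie0.
  apply: lee_nneseries => [|k _]; first by move=> k _ _; exact: S0.
  have [_ _ HVk] := HV k.
  have : (mu (V k `&` `]a, b]) <= mu (E k) + mu (V k `\` E k))%E.
    rewrite -measureU//; last 3 first.
    - exact: mE.
    - exact: mVE.
    - by rewrite setDIK.
    apply: le_measure; rewrite ?inE.
    - exact: mVI.
    - by apply: measurableU; [exact: mE|exact: mVE].
    by rewrite setDUK//; exact: subIsetl.
  move=> hle; apply: le_trans (lee_wpmul2l (w0 k) hle) _.
  rewrite ge0_muleDr//; apply: leeD.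
    apply: le_trans (_ : \int[mu]_(x in E k) (k.+1%:R * e)%:E <= _)%E.
      by rewrite le_eqVlt (integral_cst mu (mE k) (k.+1%:R * e)%:E) eqxx.
    apply: ge0_le_integral => //.
    - exact: mE.
    - exact: measurable_funS mphie.
    - move=> x [xab]; rewrite /lvl/= in_itv/= => /andP[h _].
      by rewrite lee_fin -natr1 mulrDl mul1r lerD2r.
  apply: le_trans (lee_wpmul2l (w0 k) (ltW HVk)) _.
  rewrite -EFinM lee_fin le_eqVlt; apply/orP; left; apply/eqP.
  by field; rewrite !gt_eqF// ltr0n// expn_gt0.
(* The difference quotients are controlled only inside []a, b[], so the induction runs on closed
   subintervals; the endpoints are recovered at the end by continuity of [m]. *)
have step a' b' : a < a' -> a' <= b' -> b' < b ->
    (`|m b' - m a'|%:E <= S a' b' + (e * (b' - a'))%:E)%E.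
  move=> aa' ab' bb'.
  pose Q x y := (`|m y - m x|%:E <= S x y + (e * (y - x))%:E)%E.
  apply: (@interval_additive_induction R Q) => // [x y z _ xy yz _ Qxy Qyz|x].
    rewrite /Q (SD x y z)//.
    apply: (@le_trans _ _ (`|m y - m x|%:E + `|m z - m y|%:E)%E).
      by rewrite -EFinD lee_fin [leRHS]addrC ler_distD.
    apply: le_trans (leeD Qxy Qyz) _.
    by rewrite addeACA -EFinD -mulrDr (addrC (y - x)) subrKA.
  move=> /andP[xa xb].
  have xab : a < x < b by rewrite (lt_le_trans aa' xa) (le_lt_trans xb bb').
  have [d d0 Hd] := dm x xab e e0.
  have p0 : 0 <= phi x / e by rewrite divr_ge0 ?phi0 ?(ltW e0)//.
  have /andP[h1 h2] := truncn_itv p0.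
  (* [x] lies in [E k], so a neighbourhood of [x] lies in [V k]: the [k]-th term alone gives [S u v]
     at least [k.+1%:R * e * (v - u)], which exceeds [phi x * (v - u)]. *)
  set k := Num.truncn (phi x / e) in h1 h2.
  have Vx : V k x.
    by apply: EV; split=> //=; rewrite /lvl/= in_itv/= -ler_pdivlMr// h1 -ltr_pdivrMr.
  have /nbhs_ballP[r r0 Hr] := open_nbhs_nbhs (conj (oV k) Vx).
  exists (Num.min d r); first by rewrite lt_min d0.
  move=> u v ua ux xv vb; rewrite lt_min => /andP[uvd uvr].
  rewrite /Q; have uv : u <= v by exact: le_trans ux xv.
  have Vuv : V k `&` `]u, v] = `]u, v]%classic.
    apply: setIidr => t /=; rewrite in_itv/= => /andP[ut tv].
    apply: Hr; rewrite /ball/= ltr_norml; move: ux xv uvr ut tv; lra.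
  have : ((k.+1%:R * e * (v - u))%:E <= S u v)%E.
    apply: le_trans (nneseries_term_le k (S0 u v)).
    rewrite /= Vuv /mu/= lebesgue_measure_itv/= lte_fin.
    have [uv'|] := ltP u v; first by rewrite -EFinB -EFinM.
    by move=> vu; rewrite mule0 lee_fin (_ : v - u = 0) ?mulr0//; move: uv vu; lra.
  move=> /(leeD2r (e * (v - u))%:E) /(le_trans _); apply.
  rewrite -EFinD lee_fin -mulrDl.
  have Hv : `|m v - m x| <= (v - x) * (phi x + e).
    have := Hd (v - x); rewrite ger0_norm ?subr_ge0// addrCA subrr addr0; apply.
    by move: ux uvd; lra.
  have Hu : `|m u - m x| <= (x - u) * (phi x + e).
    have := Hd (u - x); rewrite ler0_norm ?subr_le0// opprB addrCA subrr addr0; apply.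
    by move: xv uvd; lra.
  have : `|m v - m u| <= (v - u) * (phi x + e).
    rewrite (le_trans (ler_distD (m x) _ _))// (distrC (m x)).
    by rewrite (le_trans (lerD Hv Hu))// -mulrDl subrKA.
  move=> /le_trans; apply; rewrite mulrC ler_wpM2r ?subr_ge0//.
  by rewrite lerD2r ltW// -ltr_pdivrMr.
pose C := fine (\int[mu]_(x in `]a, b[) (phi x)%:E)%E + (2 * e * (b - a) + e).
have Cint : (\int[mu]_(x in `]a, b[) (phi x)%:E + (2 * e * (b - a) + e)%:E = C%:E)%E.
  have int0 : (0 <= \int[mu]_(x in `]a, b[) (phi x)%:E)%E.
    by apply: integral_ge0 => x xab; rewrite lee_fin phi0.
  by rewrite /C [in RHS]EFinD fineK// ge0_fin_numE.
rewrite Cint lee_fin.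
have step' a' b' : a < a' -> a' <= b' -> b' < b -> `|m b' - m a'| <= C.
  move=> aa' ab' bb'; rewrite -lee_fin; apply: le_trans (step a' b' aa' ab' bb') _.
  have : (S a' b' <= S a b)%E.
    rewrite (SD a a' b (ltW aa') (le_trans ab' (ltW bb'))).
    rewrite (SD a' b' b ab' (ltW bb')) addeA addeAC.
    by apply: leeDr; apply: adde_ge0; apply: nneseries_ge0 => k _ _; exact: S0.
  move=> /le_trans/(_ Sab) /(leeD2r (e * (b' - a'))%:E) /le_trans; apply.
  rewrite -Cint -addeA -EFinD leeD2l// lee_fin.
  have : e * (b' - a') <= e * (b - a) by rewrite ler_wpM2l// ?(ltW e0)//; lra.
  lra.
have ma : m x @[x --> a^'+] --> m a.
  by apply: cvg_at_right_filter; apply: cm; rewrite in_itv/= lexx ltW.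
have mb : m x @[x --> b^'-] --> m b.
  by apply: cvg_at_left_filter; apply: cm; rewrite in_itv/= lexx ltW.
pose c := (a + b) / 2.
have hc : a < c < b by rewrite /c; move: ab => ?; lra.
have stepa b' : c <= b' -> b' < b -> `|m b' - m a| <= C.
  move=> cb' b'b; apply: (@cvgr_to_le _ a^'+ _ _ (fun a' => `|m b' - m a'|)).
    by apply: cvg_norm; apply: cvgB; [exact: cvg_cst|exact: ma].
  near=> a'; apply: step' => //.
  apply: le_trans cb'; near: a'; apply: nbhs_right_le; by case/andP: hc.
apply: (@cvgr_to_le _ b^'- _ _ (fun b' => `|m b' - m a|)).
  by apply: cvg_norm; apply: cvgB; [exact: mb|exact: cvg_cst].
near=> b'; apply: stepa => //.
by near: b'; apply: nbhs_left_ge; case/andP: hc.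
Unshelve. all: by end_near. Qed.

(** * Norms on C^p *)

Local Notation normc := ComplexField.Normc.normc.

Lemma normc_real (R : rcfType) (a : R) : normc a%:C = `|a|.
Proof. by rewrite /= expr0n addr0 sqrtr_sqr. Qed.

Lemma normc_ge0 (R : rcfType) (a : R[i]) : 0 <= normc a.
Proof. by case: a => a b; exact: sqrtr_ge0. Qed.

Lemma normc_le_l1 (R : rcfType) (a : R[i]) :
  normc a <= `|complex.Re a| + `|complex.Im a|.
Proof.
case: a => a b /=; rewrite -(ler_pXn2r (_ : (0 < 2)%N)) ?nnegrE//.
rewrite sqr_sqrtr ?addr_ge0 ?sqr_ge0// sqrrD !real_normK ?num_real//.
by rewrite lerD2r lerDl mulrn_wge0// mulr_ge0.
Qed.

Definition l1norm (R : realType) (p : nat) (x : 'cV[R[i]]_p) : R :=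
  \sum_i (`|complex.Re (x i 0)| + `|complex.Im (x i 0)|).

Lemma complex_ReB (R : rcfType) (a b : R[i]) :
  complex.Re (a - b) = complex.Re a - complex.Re b.
Proof. by case: a b => ? ? []. Qed.

Lemma complex_ImB (R : rcfType) (a b : R[i]) :
  complex.Im (a - b) = complex.Im a - complex.Im b.
Proof. by case: a b => ? ? []. Qed.

Lemma ReIm_le_l1norm (R : realType) (p : nat) (x : 'cV[R[i]]_p) i :
  `|complex.Re (x i 0)| <= l1norm x /\ `|complex.Im (x i 0)| <= l1norm x.
Proof.
rewrite /l1norm (bigD1 i)//=.
have : 0 <= \sum_(j | j != i) (`|complex.Re (x j 0)| + `|complex.Im (x j 0)|).
  by apply: sumr_ge0 => j _; rewrite addr_ge0.
have := normr_ge0 (complex.Re (x i 0)); have := normr_ge0 (complex.Im (x i 0)).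
by move=> *; split; lra.
Qed.

Section NormOnCp.
Variables (R : realType) (p : nat) (nrm : 'cV[R[i]]_p -> R).
Hypothesis nrmP : is_norm nrm.
Local Notation V := 'cV[R[i]]_p.
Implicit Types (x y z : V) (M N : 'M[R[i]]_p).

Lemma nrmZ (a : R[i]) x : nrm (a *: x) = normc a * nrm x.
Proof. exact: is_normZ. Qed.

Lemma nrm0 : nrm 0 = 0.
Proof. by rewrite -(scale0r (0 : V)) nrmZ ComplexField.Normc.normc0 mul0r. Qed.

Lemma nrmN x : nrm (- x) = nrm x.
Proof.
rewrite -scaleN1r nrmZ (_ : normc (-1) = 1) ?mul1r//.
by have := @normc_real R (-1); rewrite rmorphN1 normrN1.
Qed.

Lemma nrmD x y : nrm (x + y) <= nrm x + nrm y.
Proof. exact: is_normD. Qed.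

Lemma nrm_ge0 x : 0 <= nrm x.
Proof. by have := nrmD x (- x); rewrite subrr nrm0 nrmN; lra. Qed.

Lemma nrmB x y : nrm (x - y) <= nrm x + nrm y.
Proof. by rewrite -(nrmN y) nrmD. Qed.

Lemma nrm_distC x y : nrm (x - y) = nrm (y - x).
Proof. by rewrite -nrmN opprB. Qed.

Lemma nrm_distD z x y : nrm (x - y) <= nrm (x - z) + nrm (z - y).
Proof. by rewrite (le_trans _ (nrmD _ _))// subrKA. Qed.

Lemma nrm_dist_dist x y : `|nrm x - nrm y| <= nrm (x - y).
Proof.
have := nrmD (x - y) y; have := nrmD (y - x) x.
by rewrite !subrK (nrm_distC y) ler_norml => *; apply/andP; split; lra.
Qed.

Lemma nrmZr (a : R) x : nrm (a%:C *: x) = `|a| * nrm x.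
Proof. by rewrite nrmZ normc_real. Qed.

Lemma nrm_sum (I : Type) (r : seq I) (P : pred I) (F : I -> V) :
  nrm (\sum_(i <- r | P i) F i) <= \sum_(i <- r | P i) nrm (F i).
Proof.
elim/big_ind2: _ => [|x a y b xa yb|//]; first by rewrite nrm0.
by rewrite (le_trans (nrmD _ _))// lerD.
Qed.

Lemma colvec_sum_delta x : x = \sum_i x i 0 *: delta_mx i 0.
Proof.
rewrite {1}[x]matrix_sum_delta; apply: eq_bigr => i _.
by rewrite big_ord_recl big_ord0 addr0.
Qed.

Lemma nrm_le_l1 x : nrm x <= (\sum_i nrm (delta_mx i 0)) * l1norm x.
Proof.
rewrite {1}[x]colvec_sum_delta (le_trans (nrm_sum _ _ _))// mulr_sumr.
apply: ler_sum => i _; rewrite nrmZ mulrC ler_pM ?nrm_ge0//.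
- exact: normc_ge0.
- by rewrite (bigD1 i)//= lerDl sumr_ge0// => *; exact: nrm_ge0.
- exact: normc_le_l1.
Qed.

(** Real coordinates on [C^p]: compactness of the unit sphere is taken from R^(2p). *)
Let cvec (v : 'rV[R]_(p + p)) : V :=
  \col_i (v 0 (lshift p i) +i* v 0 (rshift p i)).

Let cvecB v w : cvec (v - w) = cvec v - cvec w.
Proof. by apply/matrixP => i j; rewrite !mxE. Qed.

Let cvecZ (a : R) v : cvec (a *: v) = a%:C *: cvec v.
Proof.
by apply/matrixP => i j; rewrite !mxE; simpc.
Qed.

Let coord_le (n : nat) (v : 'rV[R]_n) j : `|v 0 j| <= `|v|.
Proof.
have /mapP[k Hk ->] : `|v 0 j| \in [seq `|v x.1 x.2| | x : 'I_1 * 'I_n].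
  by apply/mapP; exists (0, j) => //=; rewrite mem_enum.
by rewrite [leRHS]/Num.norm /= mx_normrE; apply/bigmax_geP; right => /=; exists k.
Qed.

Let l1norm_cvec v : l1norm (cvec v) <= `|v| *+ 2 *+ p.
Proof.
have -> : `|v| *+ 2 *+ p = \sum_(i < p) `|v| *+ 2 by rewrite sumr_const card_ord.
apply: ler_sum => i _.
by rewrite mxE /= mulr2n lerD ?coord_le.
Qed.

Let K1 := \sum_i nrm (delta_mx i 0).
Let K1_ge0 : 0 <= K1. Proof. by apply: sumr_ge0 => i _; exact: nrm_ge0. Qed.

Let cvec_cont : continuous (nrm \o cvec).
Proof.
move=> v; apply/(@cvgrPdist_le _ _ _ _ (nbhs_filter v)) => e e0.
have K0 : 0 < K1 * 2 * p%:R + 1 by rewrite ltr_wpDl// !mulr_ge0.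
have d0 : 0 < e / (K1 * 2 * p%:R + 1) by rewrite divr_gt0.
have /(@cvgrPdist_le _ _ _ _ (nbhs_filter v))/(_ _ d0) : id @ nbhs v --> v by exact: cvg_id.
apply: filterS => w vw; rewrite /= (le_trans (nrm_dist_dist _ _))// -cvecB.
rewrite (le_trans (nrm_le_l1 _))// -/K1.
rewrite (le_trans (ler_wpM2l K1_ge0 (l1norm_cvec _)))//.
move: vw; rewrite ler_pdivlMr// => /(le_trans _); apply.
rewrite mulrDr mulr1 -[_ *+ 2 *+ p]mulrnA -[_ *+ (2 * p)]mulr_natr natrM.
by rewrite (_ : K1 * (`|v - w| * (2%:R * p%:R)) = `|v - w| * (K1 * 2 * p%:R)) ?lerDl//; ring.
Qed.

(** Half of the equivalence of norms: [nrm] does not vanish on the compact unit sphere of R^(2p), so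
    its inverse is bounded there, and homogeneity does the rest. *)
Lemma l1_le_nrm : exists2 K, 0 < K & forall x, l1norm x <= K * nrm x.
Proof.
pose S := [set v : 'rV[R]_(p + p) | `|v| = 1].
have Sc : compact S.
  apply: bounded_closed_compact.
    by exists 1; split=> // M M1 v /= ->; exact: ltW.
  apply: (@closed_comp _ _ (fun v : 'rV[R]_(p + p) => `|v|) [set x | x = 1]).
    by move=> v _; exact: norm_continuous.
  exact: closed_eq.
have cvec0 v : `|v| = 1 -> nrm (cvec v) != 0.
  move=> v1; apply/eqP => /(is_norm_eq0 nrmP) v0.
  have : v = 0.
    apply/matrixP => i j; rewrite (ord1 i) mxE.
    have h k : v 0 (lshift p k) = 0 /\ v 0 (rshift p k) = 0.
      by have /matrixP/(_ k 0) := v0; rewrite !mxE => -[].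
    by case: (split_ordP j) => k ->; have [] := h k.
  by move=> v00; move: v1; rewrite v00 normr0 => /esym/eqP; rewrite oner_eq0.
have : compact [set (nrm (cvec v))^-1 | v in S].
  apply: continuous_compact => //; apply: continuous_in_subspaceT => v.
  rewrite inE => /cvec0 v0; apply: cvgV => //; [exact: (nbhs_filter v)|exact: cvec_cont].
move=> /compact_bounded[M [_ HM]].
have {}HM v : S v -> (nrm (cvec v))^-1 <= `|M| + 1.
  move=> Sv; rewrite (le_trans (ler_norm _))//; apply: (HM (`|M| + 1)).
    by rewrite (le_lt_trans (ler_norm M))// ltrDl.
  by exists v.
(* The factor [2 p] comes from [l1norm_cvec]; the final 1 keeps the constant positive when
   [p = 0]. *)
exists ((`|M| + 1) *+ 2 *+ p + 1).
  by rewrite ltr_wpDl// !mulrn_wge0// addr_ge0.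
move=> x; pose v : 'rV[R]_(p + p) := row_mx (\row_i complex.Re (x i 0))
  (\row_i complex.Im (x i 0)).
have xE : x = cvec v.
  apply/matrixP => i j; rewrite (ord1 j) [RHS]mxE.
  by rewrite row_mxEl row_mxEr !mxE; case: (x i 0).
have [v0|v0] := eqVneq v 0.
  rewrite (le_trans (_ : l1norm x <= 0))//.
    by rewrite xE (le_trans (l1norm_cvec _))// v0 normr0 !mul0rn.
  by rewrite mulr_ge0 ?nrm_ge0// addr_ge0// !mulrn_wge0// addr_ge0.
have nv0 : 0 < `|v| by rewrite normr_gt0.
have : S (`|v|^-1 *: v).
  by rewrite /S /= normrZ normfV normr_id mulVf// gt_eqF.
move=> /[dup] Sv /HM; rewrite cvecZ nrmZr normfV normr_id invfM invrK -xE.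
have nx0 : 0 < nrm x.
  rewrite lt_neqAle nrm_ge0 andbT eq_sym.
  have := cvec0 _ Sv; rewrite cvecZ nrmZr mulf_eq0 negb_or -xE.
  by case/andP.
rewrite ler_pdivrMr// => vx.
rewrite xE (le_trans (l1norm_cvec _))// -xE.
rewrite mulrDl mul1r (le_trans (_ : _ <= (`|M| + 1) *+ 2 *+ p * nrm x))//.
  by rewrite !mulrnAl !lerMn2r vx !orbT.
by rewrite lerDl ltW.
Unshelve. all: by end_near. Qed.

End NormOnCp.

Lemma cvg0_le (R : realType) (T : Type) (F : set_system T) {FF : Filter F}
    (a b : T -> R) :
  (\forall x \near F, 0 <= a x <= b x) -> b @ F --> (0 : R) -> a @ F --> (0 : R).
Proof. by move=> ab b0; apply: (squeeze_cvgr ab) => //; exact: cvg_cst. Qed.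

Lemma cvg0_sum (R : realType) (T I : Type) (F : set_system T) {FF : Filter F}
    (r : seq I) (f : I -> T -> R) : (forall i, f i @ F --> (0 : R)) ->
  (fun s => \sum_(i <- r) f i s) @ F --> (0 : R).
Proof.
move=> f0; elim: r => [|i r IH].
  by under eq_fun do rewrite big_nil; exact: cvg_cst.
under eq_fun do rewrite big_cons.
have h := cvgD (f0 i) IH; rewrite addr0 in h; exact: h.
Qed.

(** * Operator norms, and limits with respect to the given norm *)

Section OperatorNorm.
Variables (R : realType) (p : nat) (nrm : 'cV[R[i]]_p -> R).
Hypothesis nrmP : is_norm nrm.
Local Notation V := 'cV[R[i]]_p.
Local Notation opn := (opnorm nrm).
Implicit Types (x y z : V) (M N : 'M[R[i]]_p).

(** A finite sum over the columns that dominates [opnorm] up to a constant: it shows that the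
    supremum in [opnorm] is finite and lets limits be checked column by column. *)
Definition colnorm M : R := \sum_j nrm (M *m delta_mx j 0).

Lemma colnorm_ge0 M : 0 <= colnorm M.
Proof. by apply: sumr_ge0 => j _; exact: (nrm_ge0 nrmP). Qed.

Lemma nrm_mulmx_l1 M x : nrm (M *m x) <= colnorm M * l1norm x.
Proof.
rewrite {1}[x]colvec_sum_delta mulmx_sumr.
rewrite (le_trans (nrm_sum nrmP _ _ _))// mulr_sumr; apply: ler_sum => j _.
rewrite -scalemxAr (nrmZ nrmP) mulrC ler_pM ?(nrm_ge0 nrmP) ?normc_ge0 ?normc_le_l1//.
by rewrite /colnorm (bigD1 j)//= lerDl sumr_ge0// => *; exact: (nrm_ge0 nrmP).
Qed.

Lemma colnorm_bound : exists2 K, 0 < K & forall M x, nrm (M *m x) <= K * colnorm M * nrm x.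
Proof.
have [K K0 HK] := l1_le_nrm nrmP; exists K => // M x.
rewrite (le_trans (nrm_mulmx_l1 _ _))// (mulrC K) -mulrA.
by rewrite ler_wpM2l ?colnorm_ge0.
Qed.

Lemma opnorm_has_sup M : has_sup [set nrm (M *m x) | x in [set x | nrm x <= 1]].
Proof.
split; first by exists (nrm (M *m 0)); exists 0 => //=; rewrite (nrm0 nrmP).
have [K K0 HK] := colnorm_bound.
exists (K * colnorm M) => _ [x /= x1 <-]; rewrite (le_trans (HK _ _))//.
by rewrite ler_piMr// mulr_ge0 ?colnorm_ge0// ltW.
Qed.

Lemma opnorm_ge0 M : 0 <= opn M.
Proof.
apply: ub_le_sup; first by have [] := opnorm_has_sup M.
by exists 0 => /=; rewrite ?mulmx0 (nrm0 nrmP).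
Qed.

Lemma nrm_mulmx M x : nrm (M *m x) <= opn M * nrm x.
Proof.
have [x0|x0] := eqVneq (nrm x) 0.
  by rewrite (is_norm_eq0 nrmP x0) mulmx0 (nrm0 nrmP) mulr0.
have xp : 0 < nrm x by rewrite lt_neqAle eq_sym x0 (nrm_ge0 nrmP).
rewrite -ler_pdivrMr//; apply: ub_le_sup; first by have [] := opnorm_has_sup M.
exists ((nrm x)^-1%:C *: x) => /=.
  by rewrite (nrmZr nrmP) ger0_norm ?invr_ge0 ?(ltW xp)// mulVf.
by rewrite -scalemxAr (nrmZr nrmP) ger0_norm ?invr_ge0 ?(ltW xp)// mulrC.
Qed.

Lemma opnorm_le M (C : R) : 0 <= C -> (forall x, nrm (M *m x) <= C * nrm x) -> opn M <= C.
Proof.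
move=> C0 MC; apply: ge_sup; first by have [] := opnorm_has_sup M.
by move=> _ [x /= x1 <-]; rewrite (le_trans (MC x))// ler_piMr.
Qed.

Lemma opnormD M N : opn (M + N) <= opn M + opn N.
Proof.
apply: opnorm_le => [|x]; first by rewrite addr_ge0 ?opnorm_ge0.
by rewrite mulmxDl (le_trans (nrmD nrmP _ _))// mulrDl lerD ?nrm_mulmx.
Qed.

Lemma opnormM M N : opn (M *m N) <= opn M * opn N.
Proof.
apply: opnorm_le => [|x]; first by rewrite mulr_ge0 ?opnorm_ge0.
by rewrite -mulmxA (le_trans (nrm_mulmx _ _))// -mulrA ler_wpM2l ?opnorm_ge0 ?nrm_mulmx.
Qed.

Lemma opnormN M : opn (- M) = opn M.
Proof.
by congr sup; apply/seteqP; split => _ [x x1 <-]; exists x => //;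
  rewrite mulNmx (nrmN nrmP).
Qed.

Lemma opnorm_dist_dist M N : `| opn M - opn N | <= opn (M - N).
Proof.
have := opnormD (M - N) N; have := opnormD (N - M) M.
rewrite !subrK -(opnormN (N - M)) opprB ler_norml => *.
by apply/andP; split; lra.
Qed.

Lemma opnorm_le_colnorm : exists2 K, 0 < K & forall M, opn M <= K * colnorm M.
Proof.
have [K K0 HK] := colnorm_bound; exists K => // M.
by apply: opnorm_le => //; rewrite mulr_ge0 ?colnorm_ge0// ltW.
Qed.

Section Limits.
Variables (T : Type) (F : set_system T).
Context {FF : Filter F}.
Implicit Types (u v : T -> V) (m : T -> 'M[R[i]]_p).

(** Convergence in the given norm, stated as a real limit so that it never has to be compared with a
    topology on [V]. *)
Definition nlim (F : set_system T) u x := (fun s => nrm (u s - x)) @ F --> (0 : R).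

Lemma nlim_le u x (a : T -> R) :
  (\forall s \near F, nrm (u s - x) <= a s) -> a @ F --> (0 : R) -> nlim F u x.
Proof.
move=> ua; apply: cvg0_le.
by apply: filterS ua => s ->; rewrite (nrm_ge0 nrmP).
Qed.

Lemma nlim_congr u v x : (\forall s \near F, u s = v s) -> nlim F u x -> nlim F v x.
Proof. by move=> uv; apply: nlim_le; apply: filterS uv => s ->. Qed.

Lemma nlim_cst x : nlim F (fun=> x) x.
Proof.
apply: (@nlim_le _ _ (cst 0)); last exact: cvg_cst.
by apply: nearW => s; rewrite subrr (nrm0 nrmP).
Qed.

Lemma nlimD u v x y : nlim F u x -> nlim F v y -> nlim F (fun s => u s + v s) (x + y).
Proof.
move=> ux vy; apply: (@nlim_le _ _ (fun s => nrm (u s - x) + nrm (v s - y))).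
  by apply: nearW => s; rewrite opprD addrACA (nrmD nrmP).
by rewrite -[X in _ --> X]addr0; exact: cvgD.
Qed.

Lemma nlim_mulmxr m M x : (fun s => opn (m s - M)) @ F --> (0 : R) ->
  nlim F (fun s => m s *m x) (M *m x).
Proof.
move=> mM; apply: (@nlim_le _ _ (fun s => opn (m s - M) * nrm x)).
  by apply: nearW => s; rewrite -mulmxBl nrm_mulmx.
by rewrite -[X in _ --> X](mul0r (nrm x)); apply: cvgM => //; exact: cvg_cst.
Qed.

Lemma nlim_mulmx m M u x : (fun s => opn (m s - M)) @ F --> (0 : R) ->
  nlim F u x -> nlim F (fun s => m s *m u s) (M *m x).
Proof.
move=> mM ux.
apply: (@nlim_le _ _ (fun s =>
    (opn (m s - M) + opn M) * nrm (u s - x) + opn (m s - M) * nrm x)).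
  apply: nearW => s.
  rewrite (_ : _ - _ = m s *m (u s - x) + (m s - M) *m x); last first.
    by rewrite mulmxBr mulmxBl subrKA.
  rewrite (le_trans (nrmD nrmP _ _))// lerD ?nrm_mulmx//.
  rewrite (le_trans (nrm_mulmx _ _))// ler_wpM2r ?(nrm_ge0 nrmP)//.
  by rewrite -{1}(subrK M (m s)) opnormD.
have h0 : ((0 + opn M) * 0 + 0 * nrm x = 0) by rewrite mulr0 mul0r addr0.
rewrite -[X in _ --> X]h0; apply: cvgD; apply: cvgM => //; last exact: cvg_cst.
by apply: cvgD => //; exact: cvg_cst.
Qed.

Lemma nlim_mulmxl M u x : nlim F u x -> nlim F (fun s => M *m u s) (M *m x).
Proof.
move=> ux; apply: nlim_mulmx => //; apply: cvg0_le (cvg_cst 0).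
by apply: nearW => s; rewrite opnorm_ge0 (le_trans (opnorm_le (lexx 0) _))// => y;
  rewrite subrr mul0mx (nrm0 nrmP) mul0r.
Qed.

Lemma nlimN u x : nlim F u x -> nlim F (fun s => - u s) (- x).
Proof.
move=> ux; apply: (@nlim_le _ _ (fun s => nrm (u s - x))) => //.
by apply: nearW => s; rewrite -opprD (nrmN nrmP).
Qed.

Lemma nlimB u v x y : nlim F u x -> nlim F v y -> nlim F (fun s => u s - v s) (x - y).
Proof. by move=> ux vy; apply: nlimD => //; exact: nlimN. Qed.

Lemma nlim_nrm u x : nlim F u x -> (fun s => nrm (u s)) @ F --> nrm x.
Proof.
move=> ux; apply/subr_cvg0/norm_cvg0P; apply: cvg0_le ux.
by apply: nearW => s; rewrite normr_ge0 (nrm_dist_dist nrmP).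
Qed.

(** In finite dimension strong convergence is norm convergence: through [colnorm] only the basis
    vectors are tested. *)
Lemma opnorm_lim m M : (forall x, nlim F (fun s => m s *m x) (M *m x)) ->
  (fun s => opn (m s - M)) @ F --> (0 : R).
Proof.
move=> mM; have [K K0 HK] := opnorm_le_colnorm.
apply: (@cvg0_le _ _ _ _ _ (fun s => K * colnorm (m s - M))).
  by apply: nearW => s; rewrite opnorm_ge0 HK.
rewrite -[X in _ --> X](mulr0 K); apply: cvgM; first exact: cvg_cst.
apply: cvg0_sum => j.
by under eq_fun do rewrite mulmxBl; exact: mM.
Qed.

Lemma opnorm_cvg m M : (fun s => opn (m s - M)) @ F --> (0 : R) ->
  (fun s => opn (m s)) @ F --> opn M.
Proof.
move=> ux; apply/subr_cvg0/norm_cvg0P; apply: cvg0_le ux.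
by apply: nearW => s; rewrite normr_ge0 opnorm_dist_dist.
Qed.

End Limits.

Lemma nlim_sub (T : Type) (F G : set_system T) (u : T -> V) x :
  G `=>` F -> nlim F u x -> nlim G u x.
Proof. by move=> FG; apply: cvg_trans; exact: cvg_app. Qed.

Lemma nlim_nrm_le (T : Type) (F : set_system T) (FF : ProperFilter F)
    (u : T -> V) x y (C : R) :
  nlim F u x -> (\forall s \near F, nrm (u s - y) <= C) -> nrm (x - y) <= C.
Proof.
move=> ux; apply: cvgr_to_le.
by apply: nlim_nrm; apply: nlimB => //; exact: nlim_cst.
Qed.

(** Completeness of [C^p], coordinate by coordinate after comparison with [l1norm]; the rate [a] is
    inherited by the limit. *)
Lemma cauchy_nlim (x : nat -> V) (a : nat -> R) :
  (forall n m, (n <= m)%N -> nrm (x m - x n) <= a n) -> a @ \oo --> (0 : R) ->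
  exists2 l, nlim \oo x l & forall n, nrm (l - x n) <= a n.
Proof.
move=> xa a0; have [K K0 HK] := l1_le_nrm nrmP.
have cv (u : nat -> R) : (forall n m, (n <= m)%N -> `|u m - u n| <= K * a n) ->
    cvg (u @ \oo).
  move=> ua; apply/cauchy_cvgP/cauchy_ballP => e e0.
  have Ka0 : (fun n => K * a n) @ \oo --> (0 : R).
    by rewrite -(mulr0 K); apply: cvgM => //; exact: cvg_cst.
  have [N _ HN] := cvgr0_norm_lt _ Ka0 _ (divr_gt0 e0 (ltr0n R 2)).
  exists (ball (u N) (e / 2), ball (u N) (e / 2)) => /=.
    suff : (u @ \oo) (ball (u N) (e / 2)) by [].
    exists N => // n /= /ua; rewrite /ball/= distrC => /le_lt_trans; apply.
    rewrite (le_lt_trans (ler_norm _))//.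
    exact: (HN N (leqnn N)).
  move=> [y z] /= [h1 h2].
  by apply: (ball_split (z := u N)) => //; exact: ball_sym.
have cre i : cvg ((fun n => complex.Re (x n i 0)) @ \oo).
  apply: cv => n m nm; have [+ _] := ReIm_le_l1norm (x m - x n) i.
  rewrite !mxE complex_ReB => /le_trans; apply.
  by rewrite (le_trans (HK _))// ler_wpM2l ?(ltW K0)// xa.
have cim i : cvg ((fun n => complex.Im (x n i 0)) @ \oo).
  apply: cv => n m nm; have [_ +] := ReIm_le_l1norm (x m - x n) i.
  rewrite !mxE complex_ImB => /le_trans; apply.
  by rewrite (le_trans (HK _))// ler_wpM2l ?(ltW K0)// xa.
pose l : V := \col_i (lim ((fun n => complex.Re (x n i 0)) @ \oo) +i*
   lim ((fun n => complex.Im (x n i 0)) @ \oo)).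
have xl : nlim \oo x l.
  apply: (@nlim_le _ _ _ _ _ (fun n => (\sum_i nrm (delta_mx i 0)) * l1norm (x n - l))).
    by apply: nearW => n; exact: nrm_le_l1.
  rewrite -[X in _ --> X](mulr0 (\sum_i nrm (delta_mx i 0))).
  apply: cvgM; first exact: cvg_cst.
  apply: cvg0_sum => i.
  have h1 : (fun n => `|complex.Re ((x n - l) i 0)|) @ \oo --> (0 : R).
    apply/norm_cvg0P; under eq_fun do rewrite !mxE complex_ReB.
    by apply/subr_cvg0; exact: cre.
  have h2 : (fun n => `|complex.Im ((x n - l) i 0)|) @ \oo --> (0 : R).
    apply/norm_cvg0P; under eq_fun do rewrite !mxE complex_ImB.
    by apply/subr_cvg0; exact: cim.
  by have h := cvgD h1 h2; rewrite addr0 in h; exact: h.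
exists l => // n; apply: nlim_nrm_le xl _.
by exists n => // m /=; exact: xa.
Qed.

End OperatorNorm.

(** * Derivatives, primitives and Gronwall's inequality *)

(** The primitive is the integral from [b], differentiable only beyond [b]. On the [j]-th step [b]
    will be [T j - 1], so that the closed step is covered with a margin. *)
Lemma continuous_primitive (R : realType) (r : R -> R) (b : R) : continuous r ->
  exists G : R -> R, forall t, b < t ->
    (fun h => h^-1 * (G (t + h) - G t)) @ 0^' --> r t.
Proof.
move=> cr; exists (fun x => \int[@lebesgue_measure R]_(s in `[b, x]) r s) => t bt.
have t1 : t < t + 1 by rewrite ltrDl.
have ir : (@lebesgue_measure R).-integrable `[b, t + 1] (EFin \o r).
  apply: continuous_compact_integrable; first exact: segment_compact.
  by apply: continuous_in_subspaceT => x _; exact: cr.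
have [] := continuous_FTC1_closed t1 ir bt (cr t).
set G := (fun x => _); pose Q h := h^-1 * (G (t + h) - G t).
have E1 : (fun h => h^-1 *: (G (h *: 1 + t) - G t)) = Q.
  by apply/funext => h; rewrite [h *: 1]mulr1 (addrC h).
have E2 : (fun h => h^-1 *: (G (h + t) - G t)) = Q.
  by apply/funext => h; rewrite (addrC h).
by rewrite /derivable E1 /derive1 E2 => cQ <-.
Qed.

(** Both signs follow from [ln (u / v) <= u / v - 1], the denominator being at least [(1 - c) * x].
    The slope tends to [1 / x] with [c], which is the sharpness that Gronwall's inequality
    requires. *)
Lemma ln_dist_le (R : realType) (x y c : R) : 0 < x -> 0 < c -> c < 1 ->
  `|y - x| <= c * x -> `|ln y - ln x| <= `|y - x| / ((1 - c) * x).
Proof.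
move=> x0 c0 c1 yx; have cx : 0 < (1 - c) * x by rewrite mulr_gt0// subr_gt0.
have yc : (1 - c) * x <= y by move: yx; rewrite ler_norml => /andP[]; lra.
have y0 : 0 < y by exact: lt_le_trans yc.
have xc : (1 - c) * x <= x by rewrite ler_piMl ?(ltW x0)//; lra.
have H (u v : R) : 0 < u -> 0 < v -> (1 - c) * x <= v ->
    ln u - ln v <= `|u - v| / ((1 - c) * x).
  move=> u0 v0 vc; rewrite -ln_div ?posrE//.
  have := @le_ln1Dx R (u / v - 1); rewrite (addrC 1) subrK => /(_ _)/le_trans; apply.
    by have := divr_gt0 u0 v0; lra.
  rewrite -[X in _ - X](divff (lt0r_neq0 v0)) -mulrBl.
  apply: le_trans (_ : _ <= `|u - v| / v) _.
    by rewrite ler_wpM2r ?invr_ge0 ?(ltW v0)// ler_norm.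
  by rewrite ler_wpM2l// lef_pV2// posrE.
rewrite ler_norml H// andbT lerNl opprB distrC; exact: H.
Qed.

Section Derivatives.
Variables (R : realType) (p : nat) (nrm : 'cV[R[i]]_p -> R).
Hypothesis nrmP : is_norm nrm.
Local Notation V := 'cV[R[i]]_p.
Local Notation opn := (opnorm nrm).
Local Notation deriv := (deriv_along nrm).
Local Notation lim_nrm := (nlim nrm).
Implicit Types (x y z L M : V) (u v : R -> V).

Section Filtered.
Variable F : set_system R.
Context {FF : Filter F}.

Lemma derivD u v t L M : deriv F u t L -> deriv F v t M ->
  deriv F (fun s => u s + v s) t (L + M).
Proof.
move=> uL vM; have /(_ _) lim := nlimD nrmP uL vM.
apply: (nlim_congr nrmP _ lim).
by apply: nearW => h; rewrite -scalerDr opprD addrACA.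
Qed.

Lemma derivN u t L : deriv F u t L -> deriv F (fun s => - u s) t (- L).
Proof.
move=> uL; have /(_ _) lim := nlimN nrmP uL.
apply: (nlim_congr nrmP _ lim).
by apply: nearW => h; rewrite -scalerN opprB opprK addrC.
Qed.

Lemma derivB u v t L M : deriv F u t L -> deriv F v t M ->
  deriv F (fun s => u s - v s) t (L - M).
Proof. by move=> uL vM; apply: derivD => //; exact: derivN. Qed.

Lemma deriv_mulmxl (C : 'M[R[i]]_p) u t L : deriv F u t L ->
  deriv F (fun s => C *m u s) t (C *m L).
Proof.
move=> uL; have /(_ _) lim := nlim_mulmxl nrmP C uL.
apply: (nlim_congr nrmP _ lim).
by apply: nearW => h; rewrite -scalemxAr mulmxBr.
Qed.

Lemma deriv_congr u v t L : u t = v t -> (\forall h \near F, u (t + h) = v (t + h)) ->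
  deriv F u t L -> deriv F v t L.
Proof.
move=> uv nuv; apply: (nlim_congr nrmP).
by apply: filterS nuv => h ->; rewrite uv.
Qed.

Lemma deriv_mulmx (m : R -> 'M[R[i]]_p) u t L M :
  (fun h => opn (m (t + h) - m t)) @ F --> (0 : R) ->
  deriv F u t L -> deriv F (fun s => m s *m u t) t M ->
  deriv F (fun s => m s *m u s) t (m t *m L + M).
Proof.
move=> mc uL mM; have /(_ _) lim := nlimD nrmP (nlim_mulmx nrmP mc uL) mM.
apply: (nlim_congr nrmP _ (lim FF)); apply: nearW => h.
by rewrite -scalemxAr -scalerDr mulmxBr subrKA.
Qed.

End Filtered.

Lemma deriv_sub (F G : set_system R) u t L : G `=>` F ->
  deriv F u t L -> deriv G u t L.
Proof. exact: nlim_sub. Qed.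

Lemma deriv_increment u t L : deriv 0^' u t L -> forall e : R, 0 < e ->
  exists2 d : R, 0 < d & forall h, `|h| < d -> nrm (u (t + h) - u t) <= `|h| * (nrm L + e).
Proof.
move=> uL e e0; have := nlim_nrm nrmP uL => /(_ _)/cvgr_le.
move=> /(_ (nrm L + e)); rewrite ltrDl => /(_ e0).
move=> /nbhs_ballP[d /= d0 Hd]; exists d => // h hd.
have [->|h0] := eqVneq h 0; first by rewrite addr0 subrr nrm0// normr0 mul0r.
have := Hd h; rewrite /ball/= sub0r normrN => /(_ hd h0).
rewrite (nrmZr nrmP) normfV => hL.
by rewrite -(ler_pM2l (_ : 0 < `|h|^-1)) ?invr_gt0 ?normr_gt0// mulKf// normr_eq0.
Qed.

Lemma deriv_lim u t L : deriv 0^' u t L -> lim_nrm (nbhs t) u (u t).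
Proof.
move=> /deriv_increment/(_ 1 ltr01)[d d0 Hd].
apply: (@nlim_le _ _ _ nrmP _ _ _ _ _ (fun s => `|s - t| * (nrm L + 1))).
  apply/nbhs_ballP; exists d => //= s; rewrite /ball/= distrC => /Hd.
  by rewrite (addrC t) subrK.
rewrite -[X in _ --> X](mul0r (nrm L + 1)); apply: cvgM; last exact: cvg_cst.
by apply/norm_cvg0P/subr_cvg0.
Qed.

Lemma continuous_nrm u t : lim_nrm (nbhs t) u (u t) ->
  {for t, continuous (fun s => nrm (u s))}.
Proof. exact: nlim_nrm. Qed.

(** The scalar estimate applied to [nrm (u t - u a)], which vanishes at [a] and whose increments are
    at most those of [u]. *)
Lemma nrm_increment_le_integral u (phi : R -> R) (a b : R) : a < b ->
  (forall t, a <= t <= b -> lim_nrm (nbhs t) u (u t)) ->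
  measurable_fun `]a, b[ phi -> (forall t, a < t < b -> 0 <= phi t) ->
  (forall t, a < t < b -> exists2 L, deriv 0^' u t L & nrm L <= phi t) ->
  ((nrm (u b - u a))%:E <= \int[@lebesgue_measure R]_(t in `]a, b[) (phi t)%:E)%E.
Proof.
move=> ab cu mphi phi0 du.
have := @le_dist_integral R (fun t => nrm (u t - u a)) phi a b ab.
rewrite subrr nrm0// subr0 ger0_norm ?nrm_ge0//; apply => //.
  move=> t /[!in_itv]/= tab; apply: continuous_nrm; apply: nlimB => //.
    exact: cu.
  exact: nlim_cst.
move=> t tab e e0; have [L /deriv_increment/(_ e e0)[d d0 Hd] Lphi] := du t tab.
exists d => // h /Hd hd; rewrite (le_trans (nrm_dist_dist nrmP _ _))//.
by rewrite opprB addrA subrK (le_trans hd)// ler_wpM2l// lerD2r.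
Qed.

(* Applied to [ln (nrm (u t) + d)], whose derivative is at most [alpha t]. *)
Lemma gronwall u (alpha : R -> R) (a b K : R) : a < b ->
  (forall t, a <= t <= b -> lim_nrm (nbhs t) u (u t)) ->
  measurable_fun `]a, b[ alpha -> (forall t, a < t < b -> 0 <= alpha t) ->
  (forall t, a < t < b -> exists2 L, deriv 0^' u t L & nrm L <= alpha t * nrm (u t)) ->
  (\int[@lebesgue_measure R]_(t in `]a, b[) (alpha t)%:E <= K%:E)%E ->
  nrm (u b) <= nrm (u a) * expR K /\ nrm (u a) <= nrm (u b) * expR K.
Proof.
move=> ab cu malpha alpha0 du intK.
have main (d : R) : 0 < d -> `|ln (nrm (u b) + d) - ln (nrm (u a) + d)| <= K.
  move=> d0; rewrite -lee_fin; apply: le_trans intK.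
  have pos t : 0 < nrm (u t) + d by rewrite ltr_wpDl ?nrm_ge0.
  apply: (@le_dist_integral R (fun t => ln (nrm (u t) + d))) => //.
    move=> t /[!in_itv]/= tab.
    apply: (@continuous_comp _ _ _ (fun t => nrm (u t) + d) (@ln R)).
      apply: continuousD; last exact: cvg_cst.
      by apply: continuous_nrm; exact: cu.
    exact: continuous_ln.
  move=> t tab e e0; have [L uL Lalpha] := du t tab.
  have a0 := alpha0 t tab.
  have ae : 0 < alpha t + e by rewrite ltr_wpDl.
  (* With this [c] the factor [1 - c] costs only [e / 3], as [(alpha t + e) * (1 - c) = alpha t + e
     * 2 / 3]; what is left still absorbs the error [e / 3 * d] of the increment. *)
  pose c := e / 3 / (alpha t + e).
  have c0 : 0 < c by rewrite /c !divr_gt0.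
  have c1 : c < 1 by rewrite /c ltr_pdivrMr// mul1r; move: a0 e0; lra.
  have e1 : 0 < e / 3 * d by rewrite !mulr_gt0// invr_gt0.
  have [r r0 Hr] := deriv_increment uL e1.
  pose Q := alpha t * nrm (u t) + e / 3 * d.
  have Q0 : 0 < Q by rewrite /Q ltr_wpDl// mulr_ge0 ?nrm_ge0.
  have N0 := nrm_ge0 nrmP (u t).
  exists (Num.min r (c * d / Q)); first by rewrite lt_min r0 !(mulr_gt0, invr_gt0).
  move=> h; rewrite lt_min => /andP[/Hr hr]; rewrite ltr_pdivlMr// => hQ.
  have hQ' : `|nrm (u (t + h)) + d - (nrm (u t) + d)| <= `|h| * Q.
    rewrite (_ : _ - _ = nrm (u (t + h)) - nrm (u t)); last by ring.
    rewrite (le_trans (nrm_dist_dist nrmP _ _))// (le_trans hr)//.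
    by rewrite ler_wpM2l// lerD2r.
  apply: le_trans (ln_dist_le (pos t) c0 c1 _) _.
    rewrite (le_trans hQ')// (le_trans (ltW hQ))// ler_wpM2l ?(ltW c0)//.
    by rewrite lerDr.
  have cp : 0 < (1 - c) * (nrm (u t) + d) by rewrite mulr_gt0// subr_gt0.
  rewrite ler_pdivrMr// (le_trans hQ')// -mulrA ler_wpM2l//.
  have -> : (alpha t + e) * ((1 - c) * (nrm (u t) + d)) =
      (alpha t + e * 2 / 3) * (nrm (u t) + d).
    by rewrite /c; field; rewrite gt_eqF.
  rewrite /Q; have := mulr_ge0 a0 (ltW d0); have := mulr_ge0 (ltW e0) N0.
  have := mulr_ge0 (ltW e0) (ltW d0); lra.
have H (x y : R) : 0 <= x -> 0 <= y ->
    (forall d, 0 < d -> ln (x + d) - ln (y + d) <= K) -> x <= y * expR K.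
  move=> x0 y0 HK; apply/ler_addgt0Pr => e e0.
  (* The shift [d] keeps the logarithm defined where [u] vanishes. With [d = e / expR K] it adds
     exactly [e] to [y * expR K]. *)
  have d0 : 0 < e / expR K by rewrite divr_gt0// expR_gt0.
  have xd : 0 < x + e / expR K by rewrite ltr_wpDl.
  have yd : 0 < y + e / expR K by rewrite ltr_wpDl.
  have := HK _ d0; rewrite lerBlDr -ler_expR expRD !lnK ?posrE// => h.
  apply: le_trans (_ : x <= x + e / expR K) _; first by rewrite lerDl ltW.
  by rewrite (le_trans h)// mulrDr addrC mulrCA divff ?mulr1 ?gt_eqF ?expR_gt0// mulrC addrC.
split; apply: H; rewrite ?nrm_ge0// => d /main; rewrite ler_norml => /andP[]; lra.
Qed.

Lemma primitive (H : R -> V) (b a : R) : (forall t, lim_nrm (nbhs t) H (H t)) ->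
  exists F : R -> V, F a = 0 /\ forall t, b < t -> deriv 0^' F t (H t).
Proof.
move=> cH; have [K K0 HK] := l1_le_nrm nrmP.
have KH t : (fun s => K * nrm (H s - H t)) @ t --> (0 : R).
  by rewrite -(mulr0 K); apply: cvgM; [exact: cvg_cst|exact: cH].
have cre i : continuous (fun t => complex.Re (H t i 0)).
  move=> t; apply/subr_cvg0/norm_cvg0P; apply: cvg0_le (KH t).
  apply: nearW => s; rewrite normr_ge0/= (le_trans _ (HK _))//.
  by have [+ _] := ReIm_le_l1norm (H s - H t) i; rewrite !mxE complex_ReB.
have cim i : continuous (fun t => complex.Im (H t i 0)).
  move=> t; apply/subr_cvg0/norm_cvg0P; apply: cvg0_le (KH t).
  apply: nearW => s; rewrite normr_ge0/= (le_trans _ (HK _))//.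
  by have [_ +] := ReIm_le_l1norm (H s - H t) i; rewrite !mxE complex_ImB.
have /choice[G HG] : forall i, exists G : R -> R, forall t, b < t ->
    (fun h => h^-1 * (G (t + h) - G t)) @ 0^' --> complex.Re (H t i 0).
  by move=> i; apply: continuous_primitive; exact: cre.
have /choice[I HI] : forall i, exists G : R -> R, forall t, b < t ->
    (fun h => h^-1 * (G (t + h) - G t)) @ 0^' --> complex.Im (H t i 0).
  by move=> i; apply: continuous_primitive; exact: cim.
exists (fun t => \col_i ((G i t - G i a) +i* (I i t - I i a))); split.
  by apply/matrixP => i j; rewrite !mxE !subrr.
move=> t bt; rewrite /deriv_along.
set D := (X in (fun h => nrm (X h)) @ _ --> _).
apply: (@cvg0_le _ _ _ _ _ (fun h => (\sum_i nrm (delta_mx i 0)) * l1norm (D h))).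
  by apply: nearW => h; rewrite nrm_ge0// nrm_le_l1.
rewrite -[X in _ --> X](mulr0 (\sum_i nrm (delta_mx i 0))).
apply: cvgM; first exact: cvg_cst.
apply: cvg0_sum => i.
have ReE h : complex.Re (D h i 0) = h^-1 * (G i (t + h) - G i t) - complex.Re (H t i 0).
  by rewrite /D !mxE; case: (H t i 0) => c d; simpc; rewrite /=; ring.
have ImE h : complex.Im (D h i 0) = h^-1 * (I i (t + h) - I i t) - complex.Im (H t i 0).
  by rewrite /D !mxE; case: (H t i 0) => c d; simpc; rewrite /=; ring.
have h1 : (fun h => `|complex.Re (D h i 0)|) @ 0^' --> (0 : R).
  apply/norm_cvg0P; under eq_fun do rewrite ReE.
  by apply/subr_cvg0; exact: HG.
have h2 : (fun h => `|complex.Im (D h i 0)|) @ 0^' --> (0 : R).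
  apply/norm_cvg0P; under eq_fun do rewrite ImE.
  by apply/subr_cvg0; exact: HI.
by have h := cvgD h1 h2; rewrite addr0 in h; exact: h.
Qed.

End Derivatives.

(** * Inhomogeneous solutions built step by step *)

Section StepSolutions.
Variables (R : realType) (p : nat) (nrm : 'cV[R[i]]_p -> R).
Hypothesis nrmP : is_norm nrm.
Local Notation V := 'cV[R[i]]_p.
Local Notation opn := (opnorm nrm).
Local Notation deriv := (deriv_along nrm).
Local Notation lim_nrm := (nlim nrm).

Variables (T zt : nat -> R).
Hypothesis T_lt : forall j, T j < T j.+1.
Hypothesis zt_itv : forall j, T j <= zt j <= T j.+1.
Hypothesis T_index : forall t, T 0 <= t -> exists j, T j <= t < T j.+1.

Variables (X U : R -> 'M[R[i]]_p) (P : 'M[R[i]]_p) (M c : R).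
Hypothesis X_unit : forall t, X t \in unitmx.
Hypothesis U_unit : forall t, U t \in unitmx.
Hypothesis X_cont : forall t, (fun s => opn (X s - X t)) @ t --> (0 : R).
Hypothesis M_ge0 : 0 <= M.
Hypothesis c_ge0 : 0 <= c.
Hypothesis X_bound : forall j s t,
  (T j <= s <= zt j /\ T j <= t <= zt j) \/
  (zt j <= s <= T j.+1 /\ zt j <= t <= T j.+1) ->
  opn (X t *m invmx (X s)) <= M.
Hypothesis U_stable : forall s t, T 0 <= s -> s <= t ->
  opn (U t *m P *m invmx (U s)) <= c.
Hypothesis U_unstable : forall s t, T 0 <= t -> t < s ->
  opn (U t *m (1%:M - P) *m invmx (U s)) <= c.

Lemma T_le i j : (i <= j)%N -> T i <= T j.
Proof.
by move=> /subnK <-; elim: (j - i)%N => // k IH; rewrite (le_trans IH)// ltW// T_lt.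
Qed.

Lemma T_index_unique i j t : T i <= t < T i.+1 -> T j <= t < T j.+1 -> i = j.
Proof.
move=> /andP[i1 i2] /andP[j1 j2].
have [/T_le h|/T_le h|//] := ltngtP i j; exfalso; lra.
Qed.

Definition jump (Q : nat -> R -> V) l : V :=
  X (T l.+1) *m (Q l (T l.+1) - Q l.+1 (T l.+1)).

(** The jump pulled back by [U], so that jumps at different grid points can be added. *)
Definition jump0 (Q : nat -> R -> V) l : V := invmx (U (T l.+1)) *m jump Q l.

(* [w] solves the inhomogeneous equation with forcing [h j] on the [j]-th step:
   there [X * Q j] is a particular solution vanishing at [zt j], and the jumps of
   these are compensated by the homogeneous solution, split along [P]. *)
Record step_solution (h : nat -> R -> V) (Q : nat -> R -> V) (L : V) (w : R -> V)
    : Prop := {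
  step_zt : forall j, Q j (zt j) = 0;
  step_deriv : forall j t, T j - 1 < t ->
    deriv 0^' (Q j) t (invmx (X t) *m h j t);
  step_lim : lim_nrm \oo (fun n => \sum_(l < n) (1%:M - P) *m jump0 Q l) L;
  step_val : forall j t, T j <= t <= T j.+1 ->
    w t = X t *m Q j t + U t *m (\sum_(l < j) jump0 Q l - L) }.

Lemma jumpB Q Q' l :
  jump (fun j t => Q j t - Q' j t) l = jump Q l - jump Q' l.
Proof. by rewrite /jump -mulmxBr /= !opprD !opprK addrACA. Qed.

(** By linearity, Lipschitz estimates in the forcing become mere bounds for the difference. *)
Lemma step_solutionB h Q L w h' Q' L' w' :
  step_solution h Q L w -> step_solution h' Q' L' w' ->
  step_solution (fun j t => h j t - h' j t) (fun j t => Q j t - Q' j t) (L - L')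
    (fun t => w t - w' t).
Proof.
move=> [z1 d1 l1 v1] [z2 d2 l2 v2].
have jB l : jump0 (fun j t => Q j t - Q' j t) l = jump0 Q l - jump0 Q' l.
  by rewrite /jump0 jumpB mulmxBr.
split=> [j|j t jt||j t jt].
- by rewrite z1 z2 subrr.
- by rewrite mulmxBr; apply: derivB => //; [exact: d1|exact: d2].
- under eq_fun do under eq_bigr do rewrite jB mulmxBr.
  under eq_fun do rewrite sumrB; exact: nlimB.
- rewrite (v1 j t jt) (v2 j t jt).
  under [in RHS]eq_bigr do rewrite jB.
  rewrite sumrB (_ : _ - _ - (L - L') = (\sum_(l < j) jump0 Q l - L) -
    (\sum_(l < j) jump0 Q' l - L')); last by rewrite !opprD !opprK addrACA.
  by rewrite !(mulmxBr _ (Q j t)) (mulmxBr (U t) (_ - L)) opprD addrACA.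
Qed.

Definition step_bound (h : nat -> R -> V) (phi : R -> R) (E : nat -> R) : Prop :=
  forall j, [/\ measurable_fun `]T j, T j.+1[ phi,
    forall s, T j < s < T j.+1 -> nrm (h j s) <= phi s &
    (\int[@lebesgue_measure R]_(s in `]T j, T j.+1[) (phi s)%:E <= (E j)%:E)%E].

Section Bounds.
Variables (h : nat -> R -> V) (phi : R -> R) (E : nat -> R).
Hypothesis hE : step_bound h phi E.
Variables (Q : nat -> R -> V).
Hypothesis Q0 : forall j, Q j (zt j) = 0.
Hypothesis dQ : forall j t, T j - 1 < t -> deriv 0^' (Q j) t (invmx (X t) *m h j t).

Lemma step_bound_ge0 j : 0 <= E j.
Proof.
have [_ hphi hE'] := hE j; rewrite -lee_fin; apply: le_trans hE'.
by apply: integral_ge0 => s /hphi /(le_trans (nrm_ge0 nrmP _)); rewrite lee_fin.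
Qed.

(** [X t *m Q j t] is the increment of [s |-> X t *m Q j s] between its zero [zt j] and [t]. Its
    derivative [X t *m invmx (X s) *m h j s] is at most [M * phi s], because [s] stays on the same
    side of [zt j] as [t]. *)
Lemma particular_le j t : T j <= t <= T j.+1 -> nrm (X t *m Q j t) <= M * E j.
Proof.
move=> /andP[jt tj]; have /andP[jz zj] := zt_itv j; have [mphi hphi hE'] := hE j.
have E0 := step_bound_ge0 j.
have main (a b : R) : T j <= a -> a < b -> b <= T j.+1 ->
    (forall s, a < s < b -> opn (X t *m invmx (X s)) <= M) ->
    nrm (X t *m Q j b - X t *m Q j a) <= M * E j.
  move=> ja ab bj Mab; rewrite -lee_fin.
  have sub : `]a, b[ `<=` `]T j, T j.+1[.
    by move=> s /=; rewrite !in_itv/= => /andP[]; move: ja bj; lra.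
  have mab : measurable_fun `]a, b[ (fun s => M * phi s).
    by apply: measurable_funM => //; apply: measurable_funS mphi.
  have phi0 s : T j < s < T j.+1 -> 0 <= phi s.
    by move=> /hphi; apply: le_trans; exact: nrm_ge0.
  have ab' s : a < s < b -> T j < s < T j.+1.
    by move=> /andP[]; move: ja bj; lra.
  apply: le_trans (_ : \int[@lebesgue_measure R]_(s in `]a, b[) (M * phi s)%:E <= _)%E.
    apply: (@nrm_increment_le_integral _ _ _ nrmP (fun s => X t *m Q j s)) => //.
    - move=> s /andP[as_ _]; apply: nlim_mulmxl => //.
      by apply: deriv_lim => //; apply: dQ; move: ja as_; lra.
    - by move=> s /ab' /phi0; exact: mulr_ge0.
    - move=> s sab; exists (X t *m (invmx (X s) *m h j s)).
        by apply: deriv_mulmxl => //; apply: dQ; move: ja sab; lra.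
      rewrite mulmxA (le_trans (nrm_mulmx nrmP _ _))//.
      by rewrite ler_pM ?(opnorm_ge0 nrmP) ?nrm_ge0 ?Mab// hphi// ab'.
  under eq_integral do rewrite EFinM.
  have mE : measurable_fun `]T j, T j.+1[ (EFin \o phi) by apply/measurable_EFinP.
  rewrite ge0_integralZl//; last first.
  - by move=> s /ab' /phi0; rewrite lee_fin.
  - by apply: measurable_funS mE.
  rewrite EFinM lee_wpmul2l ?lee_fin//; apply: le_trans hE'.
  exact: ge0_subset_integral.
have [tz|tz|tz] := ltgtP t (zt j).
- have := main t (zt j) jt tz zj; rewrite Q0 mulmx0 sub0r nrmN//; apply => s /andP[ts sz].
  by apply: (X_bound (j := j)); left; split; apply/andP; split; lra.
- have := main (zt j) t jz tz tj; rewrite Q0 mulmx0 subr0; apply => s /andP[ts sz].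
  by apply: (X_bound (j := j)); right; split; apply/andP; split; lra.
- by rewrite tz Q0 mulmx0 nrm0// mulr_ge0.
Qed.

Lemma jump_le l : nrm (jump Q l) <= M * (E l + E l.+1).
Proof.
rewrite /jump mulmxBr (le_trans (nrmB nrmP _ _))// mulrDr lerD//.
  by apply: particular_le; rewrite lexx andbT ltW.
by apply: particular_le; rewrite lexx/= ltW.
Qed.

Variable S : R.
Hypothesis ES : forall n, \sum_(j < n) E j <= S.

Lemma step_bound_le j : E j <= S.
Proof.
apply: le_trans (ES j.+1); rewrite big_ord_recr /= lerDr sumr_ge0// => i _.
exact: step_bound_ge0.
Qed.

(** Each step integral enters the jumps at both ends of its step, whence the factor 2. *)
Lemma sum_jump_le n : \sum_(l < n) nrm (jump Q l) <= 2 * M * S.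
Proof.
apply: le_trans (_ : \sum_(l < n) M * (E l + E l.+1) <= _).
  by apply: ler_sum => l _; exact: jump_le.
rewrite -mulr_sumr big_split/= (mulrC 2) -mulrA ler_wpM2l//.
rewrite mulr2n mulrDl !mul1r; apply: lerD; first exact: ES.
apply: le_trans (ES n.+1); rewrite big_ord_recl -[leLHS]add0r lerD//.
exact: step_bound_ge0.
Qed.

End Bounds.

(** The jumps with [l >= n] sit at [T l.+1], after [t] because [t < T n.+1], so each is seen through
    the unstable kernel. *)
Lemma unstable_sum_le Q t n m : (n <= m)%N -> T 0 <= t -> t < T n.+1 ->
  nrm (U t *m (\sum_(n <= l < m) (1%:M - P) *m jump0 Q l)) <=
    c * \sum_(n <= l < m) nrm (jump Q l).
Proof.
move=> nm t0 tn; rewrite mulmx_sumr mulr_sumr (le_trans (nrm_sum nrmP _ _ _))//.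
rewrite big_nat_cond [leRHS]big_nat_cond; apply: ler_sum => l /andP[/andP[nl lm] _].
rewrite /jump0 (mulmxA (U t)) (mulmxA _ (invmx _)).
rewrite (le_trans (nrm_mulmx nrmP _ _))// ler_wpM2r ?nrm_ge0//.
by apply: U_unstable => //; apply: lt_le_trans tn _; exact: T_le.
Qed.

Lemma stable_sum_le Q t n m : (n <= m)%N -> T m <= t ->
  nrm (U t *m P *m (\sum_(n <= l < m) jump0 Q l)) <=
    c * \sum_(n <= l < m) nrm (jump Q l).
Proof.
move=> nm tn; rewrite mulmx_sumr mulr_sumr (le_trans (nrm_sum nrmP _ _ _))//.
rewrite big_nat_cond [leRHS]big_nat_cond; apply: ler_sum => l /andP[/andP[nl lm] _].
rewrite /jump0 (mulmxA _ (invmx _)) (le_trans (nrm_mulmx nrmP _ _))// ler_wpM2r ?nrm_ge0//.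
by apply: U_stable; [exact: T_le|rewrite (le_trans _ tn)// T_le].
Qed.

(** As [L] sums all the [1 - P] parts, the homogeneous term is the stable sum over the past jumps
    minus the unstable sum over the future ones. The first [N] jumps keep the factor
    [opn (U t *m P)], which may decay; all others cost at most [c] times their norms. [N = 0] gives
    boundedness, a large [N] the limit 0. *)
Lemma step_solution_le h phi E Q L w D N j t : step_bound h phi E ->
  step_solution h Q L w -> (forall n, \sum_(l < n) nrm (jump Q l) <= D) ->
  (N <= j)%N -> T j <= t < T j.+1 ->
  nrm (w t) <= M * E j + (opn (U t *m P) * \sum_(l < N) nrm (jump0 Q l) +
    c * (D - \sum_(l < N) nrm (jump Q l))).
Proof.
move=> hE [Q0 dQ lL val] QD Nj tj; have /andP[t1 t2] := tj.
rewrite (val j t); last by rewrite t1 ltW.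
rewrite (le_trans (nrmD nrmP _ _))// lerD//.
  by apply: (particular_le hE Q0 dQ); rewrite t1 ltW.
have t0 : T 0 <= t by rewrite (le_trans _ t1)// T_le.
(* [L] is replaced by its partial sums beyond [j], for which the estimate is uniform. *)
have := nlim_mulmxl nrmP (U t) lL; move=> /(_ _) lU.
rewrite mulmxBr nrm_distC//; apply: nlim_nrm_le lU _ => //.
exists j => // n /= jn; rewrite nrm_distC// -mulmxBr.
rewrite -!(big_mkord xpredT (fun l => jump0 Q l)).
rewrite -!(big_mkord xpredT (fun l => (1%:M - P) *m jump0 Q l)).
rewrite (big_cat_nat (leq0n _) jn)/= opprD addrA -sumrB.
rewrite (eq_bigr (fun l => P *m jump0 Q l)); last first.
  by move=> l _; rewrite mulmxBl mul1mx opprB addrC subrK.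
rewrite (big_cat_nat (leq0n _) Nj)/= -addrA mulmxDr (le_trans (nrmD nrmP _ _))// lerD//.
  rewrite -mulmx_sumr mulmxA (le_trans (nrm_mulmx nrmP _ _))//.
  rewrite ler_wpM2l ?(opnorm_ge0 nrmP)//.
  by rewrite big_mkord; exact: nrm_sum.
rewrite -mulmx_sumr mulmxDr mulmxN mulmxA (le_trans (nrmB nrmP _ _))//.
have jn' := leq_trans Nj jn.
have := QD n; rewrite -!(big_mkord xpredT (fun l => nrm (jump Q l))).
rewrite (big_cat_nat (leq0n _) jn')/= (big_cat_nat Nj jn)/= => QDn.
apply: le_trans (lerD (stable_sum_le Q Nj t1) (unstable_sum_le Q jn t0 t2)) _.
by rewrite -mulrDr ler_wpM2l//; move: QDn; lra.
Qed.

(** The case [N = 0]: at most [M * S] from the particular solution and [c] times the total jump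
    [2 * M * S]. *)
Lemma step_solution_bound h phi E S Q L w t : step_bound h phi E ->
  (forall n, \sum_(j < n) E j <= S) -> step_solution h Q L w ->
  T 0 <= t -> nrm (w t) <= M * (1 + 2 * c) * S.
Proof.
move=> hE ES hw /T_index[j tj]; have [Q0 dQ _ _] := hw.
apply: le_trans (step_solution_le hE hw (sum_jump_le hE Q0 dQ ES) (leq0n j) tj) _.
rewrite !big_ord0 mulr0 subr0 add0r.
by have := ler_wpM2l M_ge0 (step_bound_le hE ES j); lra.
Qed.

(** The limit [L] exists because, seen from [T 0], every jump lies in the future: the unstable
    kernel bounds its [1 - P] part by [c] times the norm of the jump, and [invmx (U (T 0))] pulls
    this back. The norms of the jumps are summable. *)
Lemma step_solution_exists h phi E S : step_bound h phi E ->
  (forall n, \sum_(j < n) E j <= S) ->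
  (forall j t, lim_nrm (nbhs t) (fun s => invmx (X s) *m h j s) (invmx (X t) *m h j t)) ->
  exists Q L w, step_solution h Q L w.
Proof.
move=> hE ES hc.
have /choice[Q HQ] : forall j, exists F : R -> V, F (zt j) = 0 /\
    forall t, T j - 1 < t -> deriv 0^' F t (invmx (X t) *m h j t).
  by move=> j; apply: (primitive nrmP _ _ (hc j)).
have Q0 j : Q j (zt j) = 0 by have [] := HQ j.
have dQ j t : T j - 1 < t -> deriv 0^' (Q j) t (invmx (X t) *m h j t).
  by have [_] := HQ j; exact.
pose D n := \sum_(l < n) nrm (jump Q l).
have D_homo : {homo D : n m / (n <= m)%N >-> n <= m}.
  move=> n m nm; rewrite /D -!(big_mkord xpredT (fun l => nrm (jump Q l))).
  by rewrite (big_cat_nat (leq0n _) nm)/= lerDl sumr_ge0// => l _; exact: nrm_ge0.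
have D_ub : has_ubound (range D).
  by exists (2 * M * S) => _ [n _ <-]; exact: (sum_jump_le hE Q0 dQ ES).
have D_cvg := nondecreasing_cvgn D_homo D_ub.
pose K := opn (invmx (U (T 0))) * c.
have [L lL _] : exists2 L, lim_nrm \oo (fun n => \sum_(l < n) (1%:M - P) *m jump0 Q l) L &
    forall n, nrm (L - \sum_(l < n) (1%:M - P) *m jump0 Q l) <= K * (sup (range D) - D n).
  apply: (cauchy_nlim nrmP) => [n m nm|].
    rewrite -!(big_mkord xpredT (fun l => (1%:M - P) *m jump0 Q l)).
    rewrite (big_cat_nat (leq0n _) nm)/= addrAC subrr add0r.
    rewrite -[X in nrm X](mulKmx (U_unit (T 0))) (le_trans (nrm_mulmx nrmP _ _))//.
    rewrite /K -mulrA ler_wpM2l ?(opnorm_ge0 nrmP)//.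
    apply: le_trans (unstable_sum_le Q nm (lexx _) _) _.
      by rewrite (lt_le_trans (T_lt 0))// T_le.
    rewrite ler_wpM2l// lerBrDr.
    have -> : \sum_(n <= l < m) nrm (jump Q l) + D n = D m.
      rewrite /D -!(big_mkord xpredT (fun l => nrm (jump Q l))).
      by rewrite (big_cat_nat (leq0n _) nm)/= addrC.
    by apply: ub_le_sup => //; exists m.
  rewrite -[X in _ --> X](mulr0 K) -(subrr (sup (range D))).
  apply: cvgM; first exact: cvg_cst.
  by apply: cvgB => //; exact: cvg_cst.
(* The index of the step that contains [t]; before [T 0] any value will do. *)
have /choice[k Hk] : forall t, exists j, T 0 <= t -> T j <= t < T j.+1.
  move=> t; have [/T_index[j tj]|t0] := leP (T 0) t; first by exists j.
  by exists 0%N.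
exists Q, L, (fun t => X t *m Q (k t) t + U t *m (\sum_(l < k t) jump0 Q l - L)).
split=> // j t /andP[jt tj].
have t0 : T 0 <= t by rewrite (le_trans _ jt)// T_le.
have kt := Hk t t0.
(* At the right end of the step the definition already uses the index [j.+1]; its extra summand
   [U t *m jump0 Q j] is exactly the difference of the two particular solutions there. *)
move: tj; rewrite le_eqVlt => /predU1P[tj|tj]; last first.
  by have -> : k t = j by apply: T_index_unique kt _; rewrite jt.
have -> : k t = j.+1 by apply: T_index_unique kt _; rewrite tj lexx T_lt.
rewrite big_ord_recr/= addrAC mulmxDr.
have -> : U t *m jump0 Q j = X t *m Q j t - X t *m Q j.+1 t.
  by rewrite /jump0 mulmxA -tj mulmxV// mul1mx /jump -tj mulmxBr.
by rewrite addrCA (addrC (X t *m Q j.+1 t)) subrK addrC.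
Qed.

(** [N] is fixed first, so that late jumps and late step integrals are small; then [opn (U t *m P)]
    tends to 0 against the finitely many early jumps. *)
Lemma step_solution_vanishes h phi E S Q L w : step_bound h phi E ->
  (forall n, \sum_(j < n) E j <= S) -> step_solution h Q L w ->
  (fun t => opn (U t *m P)) @ +oo --> (0 : R) ->
  (fun t => nrm (w t)) @ +oo --> (0 : R).
Proof.
move=> hE ES hw UP0; have [Q0 dQ _ _] := hw.
pose D n := \sum_(l < n) nrm (jump Q l).
have D_homo : {homo D : n m / (n <= m)%N >-> n <= m}.
  move=> n m nm; rewrite /D -!(big_mkord xpredT (fun l => nrm (jump Q l))).
  by rewrite (big_cat_nat (leq0n _) nm)/= lerDl sumr_ge0// => l _; exact: nrm_ge0.
have D_ub : has_ubound (range D).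
  by exists (2 * M * S) => _ [n _ <-]; exact: (sum_jump_le hE Q0 dQ ES).
have D_cvg := nondecreasing_cvgn D_homo D_ub.
have E_cvg : E @ \oo --> (0 : R).
  apply: cvg_series_cvg_0; apply: nondecreasing_is_cvgn.
    move=> n m nm; rewrite /series/= (big_cat_nat (leq0n _) nm)/= lerDl.
    by rewrite sumr_ge0// => l _; exact: step_bound_ge0 hE _.
  by exists S => _ [n _ <-]; rewrite /series/= big_mkord.
apply/cvgr0Pnorm_le => e e0.
have e4 : 0 < e / 4 by rewrite divr_gt0.
have [N1 _ HN1] : \forall n \near \oo, `|M * E n| <= e / 4.
  have : (fun n => M * E n) @ \oo --> (0 : R).
    by rewrite -(mulr0 M); apply: cvgM => //; exact: cvg_cst.
  by move=> /cvgr0_norm_le/(_ _ e4).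
have [N2 _ HN2] : \forall n \near \oo, `|c * (sup (range D) - D n)| <= e / 4.
  have : (fun n => c * (sup (range D) - D n)) @ \oo --> (0 : R).
    rewrite -[X in _ --> X](mulr0 c) -(subrr (sup (range D))).
    apply: cvgM; first exact: cvg_cst.
    by apply: cvgB => //; exact: cvg_cst.
  by move=> /cvgr0_norm_le/(_ _ e4).
pose N := maxn N1 N2.
have UP : \forall t \near +oo, `|opn (U t *m P) * \sum_(l < N) nrm (jump0 Q l)| <= e / 4.
  have : (fun t => opn (U t *m P) * \sum_(l < N) nrm (jump0 Q l)) @ +oo --> (0 : R).
    rewrite -[X in _ --> X](mul0r (\sum_(l < N) nrm (jump0 Q l))).
    by apply: cvgM => //; exact: cvg_cst.
  by move=> /cvgr0_norm_le/(_ _ e4).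
near=> t.
rewrite ger0_norm ?nrm_ge0//.
have tN : T N <= t by near: t; apply: nbhs_pinfty_ge; rewrite num_real.
have [j tj] := T_index (le_trans (T_le (leq0n N)) tN).
have Nj : (N <= j)%N.
  rewrite leqNgt; apply/negP => /T_le; case/andP: tj => _ ?; lra.
have DD n : \sum_(l < n) nrm (jump Q l) <= sup (range D).
  by apply: ub_le_sup => //; exists n.
apply: le_trans (step_solution_le hE hw DD Nj tj) _.
have h1 : M * E j <= e / 4.
  by apply: le_trans (ler_norm _) (HN1 j _); rewrite /=; exact: leq_trans (leq_maxl _ _) Nj.
have h2 : c * (sup (range D) - D N) <= e / 4.
  by apply: le_trans (ler_norm _) (HN2 N _); rewrite /=; exact: leq_maxr.
have h3 : opn (U t *m P) * \sum_(l < N) nrm (jump0 Q l) <= e / 4.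
  by apply: le_trans (ler_norm _) _; near: t.
by move: h1 h2 h3; rewrite /D; lra.
Unshelve. all: by end_near. Qed.

End StepSolutions.

(** * The fundamental matrices *)

Section MatrixLimits.
Variables (R : realType) (p : nat) (nrm : 'cV[R[i]]_p -> R).
Hypothesis nrmP : is_norm nrm.
Local Notation opn := (opnorm nrm).

Lemma opnorm_mulmx_lim (T : Type) (F : set_system T) {FF : Filter F}
    (m n : T -> 'M[R[i]]_p) M N :
  (fun s => opn (m s - M)) @ F --> (0 : R) -> (fun s => opn (n s - N)) @ F --> (0 : R) ->
  (fun s => opn (m s *m n s - M *m N)) @ F --> (0 : R).
Proof.
move=> mM nN; apply: (opnorm_lim nrmP) => x; under eq_fun do rewrite -mulmxA.
by rewrite -mulmxA; apply: nlim_mulmx => //; exact: nlim_mulmxr.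
Qed.

(* The identity [M^-1 - N^-1 = M^-1 (N - M) N^-1] first bounds [M^-1]. *)
Lemma invmx_dist_le (M N : 'M[R[i]]_p) : M \in unitmx -> N \in unitmx ->
  opn (M - N) <= (2 * (opn (invmx N) + 1))^-1 ->
  opn (invmx M - invmx N) <= 2 * opn (invmx N) * opn (invmx N) * opn (M - N).
Proof.
move=> Mu Nu; have invB : invmx M - invmx N = invmx M *m (N - M) *m invmx N.
  by rewrite mulmxBr mulVmx// mulmxBl mul1mx -mulmxA mulmxV// mulmx1.
rewrite invB; have : opn (invmx M) <= opn (invmx N) + opn (invmx M *m (N - M) *m invmx N).
  rewrite -{1}(subrK (invmx N) (invmx M)) addrC (le_trans (opnormD nrmP _ _))//.
  by rewrite lerD2l invB.
have : opn (invmx M *m (N - M) *m invmx N) <=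
    opn (invmx M) * opn (M - N) * opn (invmx N).
  rewrite -(opnormN nrmP (M - N)) opprB (le_trans (opnormM nrmP _ _))//.
  by rewrite ler_wpM2r ?(opnorm_ge0 nrmP)// opnormM.
have := opnorm_ge0 nrmP (invmx M); have := opnorm_ge0 nrmP (M - N).
have := opnorm_ge0 nrmP (invmx N); clear Mu Nu invB.
move: (opn (invmx M *m _ *m _)) (opn (invmx M)) (opn (M - N)) (opn (invmx N)).
move=> b a d K K0 d0 a0 h1 h2 h3.
have h4 : d * K <= 2^-1.
  apply: le_trans (_ : (2 * (K + 1))^-1 * (K + 1) <= _).
    by apply: ler_pM => //; lra.
  by rewrite invfM mulfVK ?lexx// gt_eqF//; lra.
have h5 : a <= 2 * K by have := ler_wpM2l a0 h4; rewrite mulrA; lra.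
apply: (le_trans h1); rewrite mulrAC; apply: ler_wpM2r => //.
exact: ler_wpM2r.
Qed.

Lemma invmx_lim (X : R -> 'M[R[i]]_p) (t : R) : (forall s, X s \in unitmx) ->
  (fun s => opn (X s - X t)) @ t --> (0 : R) ->
  (fun s => opn (invmx (X s) - invmx (X t))) @ t --> (0 : R).
Proof.
move=> Xu Xt; pose K := opn (invmx (X t)).
have e0 : 0 < (2 * (K + 1))^-1.
  by rewrite invr_gt0 mulr_gt0// ltr_wpDl// (opnorm_ge0 nrmP).
apply: (@cvg0_le _ _ _ _ _ (fun s => 2 * K * K * opn (X s - X t))); last first.
  rewrite -[X in _ --> X](mulr0 (2 * K * K)).
  by apply: cvgM; [exact: cvg_cst|exact: Xt].
near=> s; rewrite (opnorm_ge0 nrmP)/=; apply: invmx_dist_le; [exact: Xu|exact: Xu|].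
by apply: le_trans (ler_norm _) _; near: s; exact: cvgr0_norm_le.
Unshelve. all: by end_near. Qed.

Lemma opnorm_continuous (m : R -> 'M[R[i]]_p) :
  (forall t, (fun s => opn (m s - m t)) @ t --> (0 : R)) ->
  continuous (fun t => opn (m t)).
Proof. by move=> mc t; exact: opnorm_cvg. Qed.

Lemma opnormZr (a : R) (M : 'M[R[i]]_p) : opn (a%:C *: M) <= `|a| * opn M.
Proof.
apply: opnorm_le => // [|x]; first by rewrite mulr_ge0 ?opnorm_ge0.
by rewrite -scalemxAl nrmZr// -mulrA ler_wpM2l// nrm_mulmx.
Qed.

(** Carries the entrywise integrability of [A] over to its operator norm. *)
Lemma opnorm_le_entries : exists2 K, 0 < K & forall M : 'M[R[i]]_p,
  opn M <= K * \sum_i \sum_j (`|complex.Re (M i j)| + `|complex.Im (M i j)|).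
Proof.
have [K K0 HK] := opnorm_le_colnorm nrmP.
pose K1 := \sum_i nrm (delta_mx i 0).
have K10 : 0 <= K1 by apply: sumr_ge0 => i _; exact: nrm_ge0.
exists (K * (K1 + 1)); first by rewrite mulr_gt0// ltr_wpDl.
move=> M; apply: (le_trans (HK M)); rewrite -mulrA ler_wpM2l ?(ltW K0)//.
have S0 : 0 <= \sum_i \sum_j (`|complex.Re (M i j)| + `|complex.Im (M i j)|).
  by apply: sumr_ge0 => i _; apply: sumr_ge0 => j _; rewrite addr_ge0.
apply: le_trans (_ : K1 * \sum_i \sum_j (`|complex.Re (M i j)| + `|complex.Im (M i j)|) <= _).
  rewrite exchange_big mulr_sumr; apply: ler_sum => j _.
  apply: (le_trans (nrm_le_l1 nrmP _)); rewrite ler_wpM2l//.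
  apply: ler_sum => i _; rewrite mxE (bigD1 j)//= mxE !eqxx mulr1 big1 ?addr0// => k kj.
  by rewrite mxE (negbTE kj) mulr0.
by rewrite ler_wpM2r// lerDl.
Qed.

End MatrixLimits.

Lemma cvg_invn_dnbhs0 (R : realType) :
  (fun n : nat => n.+1%:R^-1 : R) @ \oo --> (0 : R)^'.
Proof.
move=> B [e /= e0 HB].
have := @cvg_harmonic R => /cvgr0_norm_lt/(_ e e0) [N _ HN].
exists N => // n /HN; rewrite /= => nB; apply: HB.
  by rewrite /ball/= sub0r normrN.
by rewrite invr_eq0 pnatr_eq0.
Qed.

Lemma integrable_entries (R : realType) (m n : nat) (D : set R)
    (M : R -> 'M[R[i]]_(m, n)) : measurable (D : set (measurableTypeR R)) ->
  integrable_mx D M ->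
  (@lebesgue_measure R).-integrable D (fun s =>
    (\sum_i \sum_j (`|complex.Re (M s i j)| + `|complex.Im (M s i j)|))%:E).
Proof.
move=> mD intM; under eq_fun do rewrite -sumEFin.
apply: integrable_sum => // i _; under eq_fun do rewrite -sumEFin.
apply: integrable_sum => // j _; have [/integrable_abse h1 /integrable_abse h2] := intM i j.
by have := integrableD mD h1 h2.
Qed.

Lemma loc_integrable_mx_itv (R : realType) (m n : nat) (a b : R)
  (M : R -> 'M[R[i]]_(m, n)) : loc_integrable_mx M -> integrable_mx `[a, b] M.
Proof.
have H (r : R -> R) : locally_integrable setT r ->
    (@lebesgue_measure R).-integrable `[a, b] (EFin \o r).
  move=> [mr _ ir]; apply/integrableP; split.
    by apply/measurable_EFinP; exact: measurable_funTS.
  by apply: ir => //; exact: segment_compact.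
by move=> intM i j; have [/H h1 /H h2] := intM i j.
Qed.

(** * Order and indexing of the grid *)

Section Grid.
Variables (R : realType) (tgrid zeta : int -> R) (gamma : R -> R).
Hypothesis grid : is_grid tgrid zeta gamma.

Lemma grid_addn i (n : nat) : tgrid i <= tgrid (i + n%:Z).
Proof.
elim: n => [|n IH]; first by rewrite addr0.
rewrite (le_trans IH)// ltW// (_ : i + n.+1%:Z = i + n%:Z + 1) ?(grid_lt grid)//.
by lia.
Qed.

Lemma grid_le i j : i <= j -> tgrid i <= tgrid j.
Proof.
by move=> ij; rewrite (_ : j = i + `|j - i|%N%:Z) ?grid_addn//; lia.
Qed.

Lemma grid_ltW i j : tgrid i < tgrid j -> i < j.
Proof. by move=> ij; rewrite ltNge; apply/negP => /grid_le; move: ij; lra. Qed.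

Lemma grid_step i t : tgrid i <= t ->
  exists n : nat, tgrid (i + n%:Z) <= t < tgrid (i + n.+1%:Z).
Proof.
move=> it; have ex : exists n : nat, t < tgrid (i + n%:Z).
  have /cvgryPgt/(_ t)[N _ HN] := grid_pinfty grid.
  exists (`|N%:Z - i|%N); apply: lt_le_trans (HN N (leqnn N)) _.
  by apply: grid_le; lia.
case: (ex_minnP ex) => -[|n] tn min; first by move: it tn; rewrite addr0; lra.
exists n; rewrite tn andbT leNgt; apply/negP => /min; lia.
Qed.

Lemma grid_not_range i t : tgrid i < t < tgrid (i + 1) -> ~ range tgrid t.
Proof.
by move=> /andP[h1 h2] [k _ kt]; move: h1 h2; rewrite -kt => /grid_ltW h1 /grid_ltW; lia.
Qed.

End Grid.

(** * Bounds on the transition matrix of [A] within a step *)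

Section Fundamental.
Variables (R : realType) (p : nat) (nrm : 'cV[R[i]]_p -> R).
Hypothesis nrmP : is_norm nrm.
Local Notation V := 'cV[R[i]]_p.
Local Notation opn := (opnorm nrm).
Local Notation deriv := (deriv_along nrm).
Local Notation lim_nrm := (nlim nrm).
Variables (tgrid zeta : int -> R) (gamma : R -> R).
Hypothesis grid : is_grid tgrid zeta gamma.

Section GlobalSolution.
Variables (F : R -> V -> V -> V) (v : R -> V).
Hypothesis sol : is_solution tgrid gamma nrm setT setT F v.

Lemma global_solution_lim t : lim_nrm (nbhs t) v (v t).
Proof. by have := solution_cont sol (I : setT t); rewrite withinET. Qed.

Let withinTrue (G : set_system R) {FG : Filter G} t : within [set h | setT (t + h)] G = G.
Proof. exact: withinET. Qed.

Lemma global_solution_deriv t : ~ range tgrid t ->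
  deriv 0^' v t (F t (v t) (v (gamma t))).
Proof. by move=> /(solution_deriv sol I); rewrite withinTrue. Qed.

Lemma global_solution_deriv_right i :
  deriv 0^'+ v (tgrid i) (F (tgrid i) (v (tgrid i)) (v (gamma (tgrid i)))).
Proof. by have := solution_deriv_right sol (I : setT (tgrid i)); rewrite withinTrue. Qed.

Lemma global_solution_deriv_left i : exists L, deriv 0^'- v (tgrid i) L.
Proof. by have := solution_deriv_left sol (I : setT (tgrid i)); rewrite withinTrue. Qed.

End GlobalSolution.

Variables (A B X : R -> 'M[R[i]]_p).
Hypothesis X_fund : is_fundamental_ode tgrid gamma nrm A X.

Lemma fundamental_unit t : X t \in unitmx. Proof. by case: X_fund. Qed.

Let X_sol xi : is_solution tgrid gamma nrm setT setT (ode_rhs A) (fun t => X t *m xi).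
Proof. by case: X_fund. Qed.

Lemma fundamental_lim t : (fun s => opn (X s - X t)) @ t --> (0 : R).
Proof. by apply: (opnorm_lim nrmP) => x; exact: (global_solution_lim (X_sol x)). Qed.

Lemma fundamental_deriv t xi : ~ range tgrid t ->
  deriv 0^' (fun t => X t *m xi) t (A t *m (X t *m xi)).
Proof. exact: global_solution_deriv (X_sol xi) t. Qed.

(** On an open step [A = X' X^-1] is the pointwise limit of the continuous functions
    [D n t *m invmx (X t)], difference quotients of [X] along [1 / (n + 1)]. *)
Lemma opnorm_measurable_open i :
  measurable_fun `]tgrid i, tgrid (i + 1)[ (fun t => opn (A t)).
Proof.
pose dn (n : nat) : R := n.+1%:R^-1.
pose D n t := (dn n)^-1%:C *: (X (t + dn n) - X t).
apply: (@measurable_fun_cvg _ _ _ _ (fun n t => opn (D n t *m invmx (X t)))) => [n|t tI].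
  apply: measurable_funTS; apply: continuous_measurable_fun.
  apply: (opnorm_continuous nrmP) => t; apply: opnorm_mulmx_lim => //; last first.
    by apply: invmx_lim => //; [exact: fundamental_unit|exact: fundamental_lim].
  have shift : (fun s => opn (X (s + dn n) - X (t + dn n))) @ t --> (0 : R).
    have c1 : (fun s => s + dn n) @ t --> t + dn n.
      by apply: cvgD; [exact: cvg_id|exact: cvg_cst].
    exact: (cvg_comp _ _ c1 (@fundamental_lim (t + dn n))).
  apply: (@cvg0_le _ _ _ _ _ (fun s => `|(dn n)^-1| *
     (opn (X (s + dn n) - X (t + dn n)) + opn (X s - X t)))).
    apply: nearW => s; rewrite (opnorm_ge0 nrmP)/= /D -scalerBr.
    rewrite (le_trans (opnormZr nrmP _ _))// ler_wpM2l//.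
    have -> : X (s + dn n) - X s - (X (t + dn n) - X t) =
        X (s + dn n) - X (t + dn n) - (X s - X t).
      by rewrite !opprB addrACA [RHS]addrACA (addrC (- X s)).
    by rewrite (le_trans (opnormD nrmP _ _))// (opnormN nrmP).
  rewrite -[X in _ --> X](mulr0 `|(dn n)^-1|) -[X in _ * X](addr0 0).
  by apply: cvgM; [exact: cvg_cst|apply: cvgD; [exact: shift|exact: fundamental_lim]].
apply: (opnorm_cvg nrmP).
have -> : A t = A t *m X t *m invmx (X t) by rewrite mulmxK// fundamental_unit.
apply: opnorm_mulmx_lim => //; last first.
  apply: (@cvg0_le _ _ _ _ _ (cst 0)); last exact: cvg_cst.
  apply: nearW => n; rewrite (opnorm_ge0 nrmP)/= opnorm_le// => x.
  by rewrite subrr mul0mx nrm0// mul0r.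
apply: (opnorm_lim nrmP) => xi; rewrite -mulmxA.
have := fundamental_deriv xi (grid_not_range grid tI).
move=> /(cvg_comp _ _ (@cvg_invn_dnbhs0 R)).
apply: cvg_trans; apply: near_eq_cvg; apply: nearW => n /=.
by rewrite /D -scalemxAl mulmxBl.
Qed.

Hypothesis A_int : loc_integrable_mx A.

Lemma opnorm_measurable i :
  measurable_fun `[tgrid i, tgrid (i + 1)] (fun t => opn (A t)).
Proof.
apply/measurable_fun_itv_bndo_bndcP/measurable_fun_itv_obnd_cbndP.
exact: opnorm_measurable_open.
Qed.

Lemma opnorm_integral_fin i :
  (\int[@lebesgue_measure R]_(s in `[tgrid i, tgrid (i + 1)]) (opn (A s))%:E < +oo)%E.
Proof.
have [K K0 HK] := opnorm_le_entries nrmP.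
have mI : measurable (`[tgrid i, tgrid (i + 1)]%classic : set (measurableTypeR R)).
  exact: measurable_itv.
have := integrable_entries mI (@loc_integrable_mx_itv _ _ _ (tgrid i) (tgrid (i + 1)) _ A_int).
move=> /(integrableZl mI K) /integrableP[mg].
apply: le_lt_trans; apply: ge0_le_integral => //.
- by move=> s _; rewrite lee_fin opnorm_ge0.
- by apply/measurable_EFinP; exact: opnorm_measurable.
- exact: measurableT_comp.
- move=> s _; rewrite -EFinM /= lee_fin (le_trans (HK _))// ler_norm//.
Qed.

(** The exponents of [rho_plus] and [rho_minus] are real-valued integrals, where [fine] would turn
    an infinite value into 0; finiteness makes them true upper bounds. *)
Let int_le (D E : set R) i : measurable (D : set (measurableTypeR R)) ->
  measurable (E : set (measurableTypeR R)) ->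
  D `<=` E -> E `<=` `[tgrid i, tgrid (i + 1)] ->
  (\int[@lebesgue_measure R]_(s in D) (opn (A s))%:E <=
    (\int[@lebesgue_measure R]_(s in E) opn (A s))%:E)%E.
Proof.
move=> mD mE DE Ei.
have mA : measurable_fun `[tgrid i, tgrid (i + 1)] (fun s => (opn (A s))%:E).
  by apply/measurable_EFinP; exact: opnorm_measurable.
have mEA : measurable_fun E (fun s => (opn (A s))%:E) by apply: measurable_funS mA.
have pos s : (0 <= (opn (A s))%:E)%E by rewrite lee_fin opnorm_ge0.
rewrite /Rintegral fineK; last first.
  rewrite ge0_fin_numE; last by apply: integral_ge0 => s _; exact: pos.
  apply: le_lt_trans (opnorm_integral_fin i).
  exact: ge0_subset_integral.
exact: ge0_subset_integral.
Qed.

Hypothesis rho_bounded : has_ubound (range (rho tgrid zeta nrm A)).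

(** Gronwall's inequality, used in both time directions, bounds the transition matrix on either part
    of a step by [rho_plus] or [rho_minus]. Both are at least 1, so each is at most their product
    [rho]. *)
Lemma transition_le : exists M : R, 1 <= M /\ forall i s t,
  (tgrid i <= s <= zeta i /\ tgrid i <= t <= zeta i) \/
  (zeta i <= s <= tgrid (i + 1) /\ zeta i <= t <= tgrid (i + 1)) ->
  opn (X t *m invmx (X s)) <= M.
Proof.
have [M HM] := rho_bounded.
have Rint0 (D : set R) : 0 <= \int[@lebesgue_measure R]_(s in D) opn (A s).
  by apply: Rintegral_ge0 => s _; exact: opnorm_ge0.
have rp i : 1 <= rho_plus tgrid zeta nrm A i by rewrite /rho_plus -expR0 ler_expR.
have rm i : 1 <= rho_minus tgrid zeta nrm A i by rewrite /rho_minus -expR0 ler_expR.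
have HM' i : rho tgrid zeta nrm A i <= M by apply: HM; exists i.
have M1 : 1 <= M.
  apply: le_trans (HM' 0); rewrite /rho -[leLHS]mulr1.
  exact: ler_pM ler01 ler01 (rp 0) (rm 0).
have rpM i : rho_plus tgrid zeta nrm A i <= M.
  by apply: le_trans (HM' i); rewrite /rho ler_peMr// (le_trans ler01).
have rmM i : rho_minus tgrid zeta nrm A i <= M.
  by apply: le_trans (HM' i); rewrite /rho ler_peMl// (le_trans ler01).
exists M; split=> // i.
have /andP[iz zi] := grid_zeta grid i.
have main (a b K : R) : tgrid i <= a -> a < b -> b <= tgrid (i + 1) ->
    (\int[@lebesgue_measure R]_(s in `]a, b[) (opn (A s))%:E <= K%:E)%E ->
    expR K <= M ->
    opn (X b *m invmx (X a)) <= M /\ opn (X a *m invmx (X b)) <= M.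
  move=> ia ab bi hK KM.
  have G xi : nrm (X b *m xi) <= nrm (X a *m xi) * expR K /\
      nrm (X a *m xi) <= nrm (X b *m xi) * expR K.
    apply: (gronwall nrmP ab (u := fun t => X t *m xi)) hK.
    - by move=> t _; exact: global_solution_lim (X_sol xi) t.
    - apply: measurable_funS (opnorm_measurable_open (i := i)) => //.
      by move=> s /=; rewrite !in_itv/= => /andP[]; move: ia bi; lra.
    - by move=> t _; exact: opnorm_ge0.
    - move=> t tab; exists (A t *m (X t *m xi)); last exact: nrm_mulmx.
      apply: fundamental_deriv; apply: (grid_not_range grid (i := i)).
      by move: tab ia bi; lra.
  have M0 : 0 <= M by rewrite (le_trans ler01).
  split; apply: opnorm_le => // x; rewrite -mulmxA.
    have [+ _] := G (invmx (X a) *m x); rewrite mulKVmx ?fundamental_unit//.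
    by move=> /le_trans; apply; rewrite mulrC ler_wpM2r ?nrm_ge0.
  have [_ +] := G (invmx (X b) *m x); rewrite mulKVmx ?fundamental_unit//.
  by move=> /le_trans; apply; rewrite mulrC ler_wpM2r ?nrm_ge0.
have diag t : opn (X t *m invmx (X t)) <= M.
  rewrite mulmxV ?fundamental_unit//; apply: le_trans M1.
  by apply: opnorm_le => // x; rewrite mul1mx mul1r.
move=> s t [] [/andP[s1 s2] /andP[t1 t2]].
- have KI a b : tgrid i <= a -> b <= zeta i ->
    (\int[@lebesgue_measure R]_(s in `]a, b[) (opn (A s))%:E <=
     (\int[@lebesgue_measure R]_(s in `[tgrid i, zeta i]) opn (A s))%:E)%E.
    move=> ia bz; apply: (int_le (i := i)) => // r /=; rewrite !in_itv/= => /andP[].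
      by move: ia bz; lra.
    by move: iz zi; lra.
  have [st|ts|->//] := ltgtP s t.
    by have [] := main s t _ s1 st (le_trans t2 zi) (KI s t s1 t2) (rpM i).
  by have [] := main t s _ t1 ts (le_trans s2 zi) (KI t s t1 s2) (rpM i).
- have KI a b : zeta i <= a -> b <= tgrid (i + 1) ->
    (\int[@lebesgue_measure R]_(s in `]a, b[) (opn (A s))%:E <=
     (\int[@lebesgue_measure R]_(s in `]zeta i, tgrid (i + 1)[) opn (A s))%:E)%E.
    move=> za bi; apply: (int_le (i := i)) => // r /=; rewrite !in_itv/= => /andP[].
      by move: za bi; lra.
    by move: iz zi; lra.
  have [st|ts|->//] := ltgtP s t.
    by have [] := main s t _ (le_trans iz s1) st t2 (KI s t s1 t2) (rmM i).
  by have [] := main t s _ (le_trans iz t1) ts s2 (KI t s t1 s2) (rmM i).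
Qed.

End Fundamental.

Lemma mulmx_ext (K : pzRingType) (m n : nat) (M N : 'M[K]_(m, n)) :
  (forall x : 'cV[K]_n, M *m x = N *m x) -> M = N.
Proof.
move=> MN; apply/matrixP => i j.
have := MN (delta_mx j 0); rewrite -!colE => /matrixP/(_ i 0).
by rewrite !mxE.
Qed.

Lemma at_right_dnbhs (R : realType) (x : R) : x^'+ `=>` x^'.
Proof.
by move=> B hB; apply: (@filterS _ (nbhs x) _ _ _ _ hB) => y By xy; apply: By; rewrite gt_eqF.
Qed.

Lemma at_left_dnbhs (R : realType) (x : R) : x^'- `=>` x^'.
Proof.
by move=> B hB; apply: (@filterS _ (nbhs x) _ _ _ _ hB) => y By xy; apply: By; rewrite lt_eqF.
Qed.

Lemma near_itvoo (R : realType) (a b t : R) : a < t < b ->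
  \forall s \near nbhs t, a < s < b.
Proof.
move=> /andP[ta tb]; near=> s; apply/andP; split; near: s.
  exact: lt_nbhsr.
exact: lt_nbhsl.
Unshelve. all: by end_near. Qed.

(** * Gluing step solutions into solutions on a ray *)

Section PiecewiseConstantSystem.
Variables (R : realType) (p : nat) (nrm : 'cV[R[i]]_p -> R).
Hypothesis nrmP : is_norm nrm.
Local Notation V := 'cV[R[i]]_p.
Local Notation opn := (opnorm nrm).
Local Notation deriv := (deriv_along nrm).
Local Notation lim_nrm := (nlim nrm).
Variables (tgrid zeta : int -> R) (gamma : R -> R).
Hypothesis grid : is_grid tgrid zeta gamma.
Variables (A B X : R -> 'M[R[i]]_p) (Z : R -> R -> 'M[R[i]]_p) (P : 'M[R[i]]_p).
Hypothesis X_fund : is_fundamental_ode tgrid gamma nrm A X.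
Hypothesis Z_fund : is_fundamental_pca tgrid gamma nrm A B Z.

Lemma pca_diag t : Z t t = 1%:M.
Proof. by apply: mulmx_ext => x; rewrite mul1mx; have [] := Z_fund t x. Qed.

(** Uniqueness: as functions of [t], both sides solve the linear equation and agree at time 0. It
    follows that [invmx (Z s 0)] is [Z 0 s], which brings the dichotomy kernel into the form assumed
    for [U]. *)
Lemma pca_cocycle t s : Z t s = Z t 0 *m Z 0 s.
Proof.
apply: mulmx_ext => x; rewrite -mulmxA.
have [_ sol _] := Z_fund s x; have [_ _ uniq] := Z_fund 0 (Z 0 s *m x).
exact: (uniq (fun t => Z t s *m x)).
Qed.

Lemma pca_unit t : Z t 0 \in unitmx.
Proof. by have := pca_cocycle t t; rewrite pca_diag => /esym/mulmx1_unit[]. Qed.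

Lemma pca_inv s : invmx (Z s 0) = Z 0 s.
Proof.
by have := pca_cocycle s s; rewrite pca_diag => h;
  rewrite -[LHS]mulmx1 h mulKmx// pca_unit.
Qed.

Let Z_sol xi : is_solution tgrid gamma nrm setT setT (linear_rhs A B)
  (fun t => Z t 0 *m xi).
Proof. by have [] := Z_fund 0 xi. Qed.

Let X_sol xi : is_solution tgrid gamma nrm setT setT (ode_rhs A) (fun t => X t *m xi).
Proof. by case: X_fund. Qed.

Variable i0 : int.
Let T (j : nat) := tgrid (i0 + j%:Z).
Let zt (j : nat) := zeta (i0 + j%:Z).

Lemma grid_succ j : T j.+1 = tgrid (i0 + j%:Z + 1).
Proof. by congr tgrid; lia. Qed.

Lemma steps_lt j : T j < T j.+1.
Proof. by rewrite grid_succ (grid_lt grid). Qed.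

Lemma steps_zt j : T j <= zt j <= T j.+1.
Proof. by rewrite grid_succ (grid_zeta grid). Qed.

Lemma steps_index t : T 0 <= t -> exists j, T j <= t < T j.+1.
Proof. by rewrite /T addr0 => /(grid_step grid). Qed.

Lemma steps_gamma j t : T j <= t < T j.+1 -> gamma t = zt j.
Proof.
rewrite grid_succ => tj; apply: (grid_gamma grid (i := i0 + j%:Z)).
by rewrite /step_interval/= in_itv.
Qed.

Variable tau : R.
Hypothesis tau_step : tgrid i0 <= tau < tgrid (i0 + 1).

Lemma tau_ge : T 0 <= tau. Proof. by rewrite /T addr0; case/andP: tau_step. Qed.

Lemma tau_gamma : gamma tau = zt 0.
Proof. by apply: steps_gamma; rewrite grid_succ /T !addr0. Qed.

Lemma ray_ge t : initial_ray gamma tau t -> T 0 <= t.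
Proof.
rewrite /initial_ray/= in_itv/= andbT tau_gamma; apply: le_trans.
by rewrite le_min tau_ge; have /andP[] := steps_zt 0.
Qed.

Lemma ray_tau t : tau <= t -> initial_ray gamma tau t.
Proof. by move=> tt; rewrite /initial_ray/= in_itv/= andbT ge_min tt. Qed.

(** On the step of [tau] one has [gamma t = gamma tau], possibly before [tau] but in the ray by its
    definition; on later steps [gamma t] lies beyond [tau]. *)
Lemma ray_gamma t : tau <= t -> initial_ray gamma tau (gamma t).
Proof.
move=> tt; have [j tj] := steps_index (le_trans tau_ge tt).
rewrite (steps_gamma tj) /initial_ray/= in_itv/= andbT ge_min tau_gamma.
case: j tj => [|j] /andP[t1 t2]; first by rewrite lexx orbT.
apply/orP; left; have /andP[+ _] := steps_zt j.+1; apply: le_trans.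
apply: le_trans (T_le steps_lt (ltn0Sn j)).
by rewrite grid_succ /T !addr0 ltW//; case/andP: tau_step.
Qed.

Lemma grid_point_step i : tau <= tgrid i -> exists j : nat, i = i0 + j%:Z.
Proof.
move=> ti; exists `|i - i0|%N; suff : i0 <= i by lia.
rewrite leNgt; apply/negP => ii0.
have : tgrid i < tgrid i0.
  apply: lt_le_trans (grid_lt grid i) _; apply: (grid_le grid); lia.
by case/andP: tau_step; move: ti; lra.
Qed.

Variables (h Q : nat -> R -> V) (L : V) (w k : R -> V).
Hypothesis w_step : step_solution nrm T zt X (fun t => Z t 0) P h Q L w.
Hypothesis k_step : forall j t, T j <= t < T j.+1 -> tau <= t -> k t = h j t.

Let cst_part j : V := \sum_(l < j) jump0 T X (fun t => Z t 0) Q l - L.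
(** The formula of step [j], read also beyond both ends of the step, so that limits and one-sided
    derivatives at grid points can be taken from it. *)
Let loc j t : V := X t *m Q j t + Z t 0 *m cst_part j.

Let w_loc j t : T j <= t <= T j.+1 -> w t = loc j t.
Proof. by move=> tj; rewrite (step_val w_step tj). Qed.

Let loc_lim j t : T j - 1 < t -> lim_nrm (nbhs t) (loc j) (loc j t).
Proof.
move=> jt; apply: nlimD => //.
  apply: nlim_mulmx => //; first exact: (fundamental_lim nrmP X_fund t).
  exact: (deriv_lim nrmP (step_deriv w_step jt)).
exact: (global_solution_lim (Z_sol _) t).
Qed.

Let loc_deriv (F : set_system R) {FF : Filter F} j t DX DU : F `=>` 0^' ->
  T j - 1 < t -> deriv F (fun s => X s *m Q j t) t DX ->
  deriv F (fun s => Z s 0 *m cst_part j) t DU -> deriv F (loc j) t (h j t + DX + DU).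
Proof.
move=> F0 jt dX dU; apply: derivD => //.
have -> : h j t = X t *m (invmx (X t) *m h j t).
  by rewrite mulKVmx// (fundamental_unit X_fund).
apply: deriv_mulmx => //; last exact: (deriv_sub F0 (step_deriv w_step jt)).
have ht : (fun h : R => t + h) @ F --> t.
  apply: cvg_trans (cvg_app _ F0) _.
  rewrite -[X in _ --> X]addr0; apply: cvgD; first exact: cvg_cst.
  exact: cvg_within.
exact: (cvg_comp _ _ ht (fundamental_lim nrmP X_fund t)).
Qed.

(** Here the particular solution has to vanish at [zt j]: [w (gamma t)] is then its homogeneous part
    alone, and [B] acts only on that part. *)
Let rhs_loc j t : T j <= t < T j.+1 -> tau <= t ->
  h j t + A t *m (X t *m Q j t) +
    (A t *m (Z t 0 *m cst_part j) + B t *m (Z (gamma t) 0 *m cst_part j)) =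
  affine_rhs A B k t (w t) (w (gamma t)).
Proof.
move=> tj tt; rewrite (steps_gamma tj) /affine_rhs (k_step tj tt).
rewrite (w_loc (steps_zt j)) (w_loc (j := j)); last by case/andP: tj => -> /ltW.
rewrite /loc (step_zt w_step) mulmx0 add0r mulmxDr.
by rewrite [RHS]addrC !addrA.
Qed.

Lemma step_solution_is_solution :
  is_solution tgrid gamma nrm (initial_ray gamma tau) `[tau, +oo[ (affine_rhs A B k) w.
Proof.
have T1 j : T j - 1 < T j by rewrite ltrBlDr ltrDl.
have ray t : `[tau, +oo[%classic t -> tau <= t by rewrite /= in_itv/= andbT.
split=> [t /ray_ge t0|t /ray tt tn|i /ray ti|i /ray ti].
- have [j tj] := steps_index t0; have /andP[jt tj1] := tj.
  have wt : w t = loc j t by apply: w_loc; rewrite jt ltW.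
  suff : lim_nrm (within (initial_ray gamma tau) (nbhs t)) w (w t) by [].
  have lj : lim_nrm (within (initial_ray gamma tau) (nbhs t)) (loc j) (loc j t).
    by apply: nlim_sub (loc_lim _); [exact: cvg_within|rewrite (lt_le_trans (T1 j))].
  (* Inside a step [w] is [loc j] around [t]. At [T 0] the ray has only a right side; at a later
     grid point the two adjacent formulas agree and are glued. *)
  move: jt; rewrite le_eqVlt => /predU1P[jt|jt]; last first.
    rewrite wt; apply: nlim_congr lj => //.
    apply: (@filterS _ (nbhs t) _ [set s | T j < s < T j.+1]).
      by move=> s /= /andP[s1 s2] _; rewrite (@w_loc j)// !ltW.
    by apply: near_itvoo; rewrite jt.
  case: j => [|j] in tj tj1 wt lj jt *.
    rewrite wt; apply: nlim_congr lj => //.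
    apply: (@filterS _ (nbhs t) _ [set s | s < T 1]).
      by move=> s /= s1 /ray_ge s0; rewrite (@w_loc 0)// s0 ltW.
    exact: lt_nbhsl.
  have wt' : w t = loc j t by apply: w_loc; rewrite -jt lexx andbT ltW// steps_lt.
  have lj' : lim_nrm (within (initial_ray gamma tau) (nbhs t)) (loc j) (loc j t).
    apply: nlim_sub (loc_lim _); first exact: cvg_within.
    by rewrite -jt (lt_trans (T1 j))// steps_lt.
  apply: (@nlim_le _ _ _ nrmP _ _ _ _ _ (fun s => nrm (loc j.+1 s - loc j.+1 t) +
     nrm (loc j s - loc j t))); last first.
    by have := cvgD lj lj'; rewrite addr0; apply.
  apply: (@filterS _ (nbhs t) _ [set s | T j < s < T j.+2]).
    move=> s /= /andP[s1 s2] _; have [ts|ts] := leP (T j.+1) s.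
      rewrite (@w_loc j.+1 s); last by rewrite ts ltW.
      by rewrite wt lerDl nrm_ge0.
    rewrite (@w_loc j s); last by rewrite (ltW ts) ltW.
    by rewrite wt' lerDr nrm_ge0.
  by apply: near_itvoo; rewrite tj1 -jt steps_lt.
- have t0 := le_trans tau_ge tt.
  have [j tj] := steps_index t0; have /andP[jt tj1] := tj.
  have jt' : T j < t.
    by rewrite lt_neqAle jt andbT; apply/eqP => jt'; apply: tn; exists (i0 + j%:Z).
  apply: (@deriv_sub _ _ _ 0^'); first exact: cvg_within.
  rewrite -(rhs_loc tj tt); apply: (@deriv_congr _ _ _ nrmP _ _ (loc j)).
  + by rewrite (@w_loc j)// jt ltW.
  + have : \forall s \near nbhs t, T j < s < T j.+1.
      by apply: near_itvoo; rewrite jt'.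
    move=> /nbhs_ballP[e /= e0 He]; exists e => //= s; rewrite /ball/= sub0r normrN => se _.
    have /andP[s1 s2] : T j < t + s < T j.+1.
      by apply: He; rewrite /ball/= opprD addNKr normrN.
    by rewrite (@w_loc j)// !ltW.
  + apply: loc_deriv => //; first by rewrite (lt_trans (T1 j)).
    exact: (global_solution_deriv (X_sol (Q j t))).
    exact: (global_solution_deriv (Z_sol (cst_part j))).
- have [j ij] := grid_point_step ti.
  have tj : T j <= tgrid i < T j.+1 by rewrite ij -/(T j) lexx steps_lt.
  apply: (@deriv_sub _ _ _ 0^'+); first exact: cvg_within.
  rewrite -(rhs_loc tj ti); apply: (@deriv_congr _ _ _ nrmP _ _ (loc j)).
  + by rewrite (@w_loc j)//; case/andP: tj => -> /ltW.
  + near=> s; rewrite (@w_loc j)// ij -/(T j); apply/andP; split.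
      by rewrite lerDl ltW//; near: s; exact: nbhs_right_gt.
    rewrite -lerBrDl ltW//; near: s; apply: nbhs_right_lt.
    by rewrite subr_gt0 steps_lt.
  + apply: loc_deriv => //.
    * exact: at_right_dnbhs.
    * by rewrite ij -/(T j).
    * exact: (global_solution_deriv_right (X_sol (Q j (tgrid i)))).
    * exact: (global_solution_deriv_right (Z_sol (cst_part j))).
(* A grid point of index [i0] in [[tau, +oo[] is [tau] itself. The left filter is improper there, so
   any value, here 0, is a derivative. *)
- have [[|j] ij] := grid_point_step ti.
    have it : tgrid i = tau.
      by apply/eqP; rewrite eq_le ti ij addr0; case/andP: tau_step => ->.
    exists 0; apply: (@nlim_le _ _ _ nrmP _ _ _ _ _ (cst 0)); last exact: cvg_cst.
    suff : \forall s \near (0:R)^'-, ~ (`[tau, +oo[%classic (tgrid i + s)).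
      by apply: filterS => s ns is_; exfalso; apply: ns.
    near=> s; rewrite /= in_itv/= andbT it lerDl => s0.
    have : s < 0 by near: s; exact: nbhs_left_lt.
    by move: s0; lra.
  have [DX dX] := global_solution_deriv_left (X_sol (Q j (tgrid i))) i.
  have [DU dU] := global_solution_deriv_left (Z_sol (cst_part j)) i.
  exists (h j (tgrid i) + DX + DU).
  apply: (@deriv_sub _ _ _ 0^'-); first exact: cvg_within.
  have iT : tgrid i = T j.+1 by rewrite ij.
  apply: (@deriv_congr _ _ _ nrmP _ _ (loc j)).
  + by rewrite (@w_loc j)// iT lexx andbT ltW// steps_lt.
  + near=> s; rewrite (@w_loc j)// iT; apply/andP; split; last first.
      by rewrite gerDl ltW//; near: s; exact: nbhs_left_lt.
    rewrite -lerBlDl ltW//; near: s; apply: nbhs_left_gt.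
    by rewrite subr_lt0 steps_lt.
  + apply: loc_deriv => //; first exact: at_left_dnbhs.
    by rewrite iT (lt_trans (T1 j))// steps_lt.
Unshelve. all: by end_near. Qed.

End PiecewiseConstantSystem.

(** * Bounded functions and solutions *)

Section StepIntegrals.
Variables (R : realType) (T : nat -> R) (a : R) (phi : R -> R).
Hypothesis T_lt : forall j, T j < T j.+1.
Hypothesis aT : a <= T 0.
Hypothesis phi_int : (@lebesgue_measure R).-integrable `[a, +oo[ (EFin \o phi).
Hypothesis phi_ge0 : forall s, 0 <= phi s.

Definition step_integral j : R := \int[@lebesgue_measure R]_(s in `]T j, T j.+1[) phi s.

Let aTj j : a <= T j.
Proof. by rewrite (le_trans aT)// (T_le T_lt). Qed.

Let itvU n : `[a, T n.+1[%classic = `[a, T n[ `|` `[T n, T n.+1[ :> set R.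
Proof.
have := aTj n; have := T_lt n => TT aT'.
apply/seteqP; split=> s /=; rewrite !in_itv/=.
  move=> /andP[as_ sT]; have [sn|sn] := ltP s (T n); [left|right].
    by rewrite as_.
  by rewrite sT.
by move=> [] /andP[h1 h2]; apply/andP; split; lra.
Qed.

Let pos s : (0 <= (phi s)%:E)%E. Proof. by rewrite lee_fin. Qed.

Let mphi (D : set R) : D `<=` `[a, +oo[ -> measurable_fun D (fun s => (phi s)%:E).
Proof.
by move=> Da; apply: measurable_funS Da _ => //; case/integrableP: phi_int.
Qed.

Let sub j : `]T j, T j.+1[ `<=` `[a, +oo[%classic.
Proof.
by move=> s /=; rewrite !in_itv/= andbT => /andP[/ltW h _]; rewrite (le_trans (aTj j)).
Qed.

Lemma step_integral_measurable j : measurable_fun `]T j, T j.+1[ phi.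
Proof. by apply/measurable_EFinP; exact: mphi. Qed.

Let total_fin : (\int[@lebesgue_measure R]_(s in `[a, +oo[) (phi s)%:E < +oo)%E.
Proof.
have /integrableP[_] := phi_int; apply: le_lt_trans.
by apply: ge0_le_integral => //; [exact: mphi|apply: measurableT_comp => //; exact: mphi|
  move=> s _; rewrite /= lee_fin ler_norm].
Qed.

Lemma step_integralE j :
  (\int[@lebesgue_measure R]_(s in `]T j, T j.+1[) (phi s)%:E = (step_integral j)%:E)%E.
Proof.
rewrite /step_integral /Rintegral fineK// ge0_fin_numE; last exact: integral_ge0.
apply: le_lt_trans total_fin; apply: ge0_subset_integral => //; first exact: mphi.
Qed.

Lemma step_integral_ge0 j : 0 <= step_integral j.
Proof. by rewrite -lee_fin -step_integralE; exact: integral_ge0. Qed.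

Lemma sum_step_integral n : \sum_(j < n) step_integral j <=
  \int[@lebesgue_measure R]_(s in `[a, +oo[) phi s.
Proof.
have sub' b : `[a, b[ `<=` `[a, +oo[%classic.
  by move=> s /=; rewrite !in_itv/= andbT => /andP[].
have H : ((\sum_(j < n) step_integral j)%:E <=
    \int[@lebesgue_measure R]_(s in `[a, T n[) (phi s)%:E)%E.
  elim: n => [|n IH]; first by rewrite big_ord0; exact: integral_ge0.
  rewrite big_ord_recr/= EFinD -step_integralE.
  rewrite itvU ge0_integral_setU//=.
  - apply: leeD => //; apply: ge0_subset_integral => //.
    + apply: mphi => s /=; rewrite !in_itv/= andbT => /andP[h _].
      exact: le_trans (aTj n) h.
    + by apply: subset_itvr; rewrite bnd_simp.
  - by rewrite -itvU; exact: mphi.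
  - by apply/disj_setPS => s [] /=; rewrite !in_itv/= => /andP[_ /lt_geF h] /andP[]; rewrite h.
rewrite -lee_fin /Rintegral fineK; last first.
  by rewrite ge0_fin_numE//; exact: integral_ge0.
apply: le_trans H _; apply: ge0_subset_integral => //; exact: mphi.
Qed.

End StepIntegrals.

Section Supnorm.
Variables (R : realType) (p : nat) (nrm : 'cV[R[i]]_p -> R).
Hypothesis nrmP : is_norm nrm.
Local Notation V := 'cV[R[i]]_p.
Variable D : set R.
Hypothesis D_neq0 : D !=set0.
Implicit Types u v : R -> V.

Definition bounded_on u := exists K : R, forall s, D s -> nrm (u s) <= K.

Definition bounded_continuous u := continuous_on nrm D u /\ bounded_on u.

Lemma bounded_onD u v : bounded_on u -> bounded_on v -> bounded_on (fun s => u s + v s).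
Proof.
move=> [K HK] [M HM]; exists (K + M) => s Ds.
by rewrite (le_trans (nrmD nrmP _ _))// lerD ?HK ?HM.
Qed.

Lemma bounded_onB u v : bounded_on u -> bounded_on v -> bounded_on (fun s => u s - v s).
Proof.
move=> [K HK] [M HM]; exists (K + M) => s Ds.
by rewrite (le_trans (nrmB nrmP _ _))// lerD ?HK ?HM.
Qed.

Lemma le_supnorm u s : bounded_on u -> D s -> nrm (u s) <= supnorm nrm D u.
Proof.
move=> [K HK] Ds; apply: ub_le_sup; last by exists s.
by exists K => _ [t Dt <-]; exact: HK.
Qed.

Lemma supnorm_le u (K : R) : (forall s, D s -> nrm (u s) <= K) -> supnorm nrm D u <= K.
Proof.
move=> HK; apply: ge_sup; last by move=> _ [s Ds <-]; exact: HK.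
by case: D_neq0 => s Ds; exists (nrm (u s)), s.
Qed.

Lemma continuous_on_uniform_limit u : (forall e : R, 0 < e -> exists2 v,
    continuous_on nrm D v & forall s, D s -> nrm (u s - v s) <= e) ->
  continuous_on nrm D u.
Proof.
move=> H t Dt; apply/cvgr0Pnorm_le => e e0.
have e3 : 0 < e / 3 by rewrite divr_gt0.
have [v cv uv] := H _ e3.
near=> s; have Ds : D s by near: s; exact: withinT.
have hs : nrm (v s - v t) <= e / 3.
  by apply: le_trans (ler_norm _) _; near: s; exact: (cvgr0_norm_le _ (cv t Dt) _ e3).
rewrite ger0_norm ?nrm_ge0//.
have := nrm_distD nrmP (v s) (u s) (u t); have := nrm_distD nrmP (v t) (v s) (u t).
have := uv s Ds; have := uv t Dt; rewrite (nrm_distC nrmP (v t)).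
by move: hs; lra.
Unshelve. all: by end_near. Qed.

Lemma continuous_onD u v : continuous_on nrm D u -> continuous_on nrm D v ->
  continuous_on nrm D (fun s => u s + v s).
Proof. by move=> cu cv t Dt; exact: (nlimD nrmP (cu t Dt) (cv t Dt)). Qed.

Lemma continuous_on_ext u v : (forall s, D s -> u s = v s) -> continuous_on nrm D u ->
  continuous_on nrm D v.
Proof.
move=> uv cu t Dt; rewrite -(uv t Dt); apply: (nlim_congr nrmP) (cu t Dt).
by apply: (@filterE _ (nbhs t)) => s; exact: uv.
Qed.

Lemma bounded_on_ext u v : (forall s, D s -> u s = v s) -> bounded_on u -> bounded_on v.
Proof. by move=> uv [K HK]; exists K => s Ds; rewrite -uv// HK. Qed.

End Supnorm.

Section SolutionAlgebra.
Variables (R : realType) (p : nat) (nrm : 'cV[R[i]]_p -> R).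
Hypothesis nrmP : is_norm nrm.
Local Notation V := 'cV[R[i]]_p.
Variables (tgrid : int -> R) (gamma : R -> R) (D I : set R).
Hypothesis ID : I `<=` D.
Hypothesis gammaID : forall t, I t -> D (gamma t).
Local Notation is_sol := (is_solution tgrid gamma nrm D I).

Lemma is_solutionD F1 F2 F3 u v : is_sol F1 u -> is_sol F2 v ->
  (forall t, I t -> F3 t (u t + v t) (u (gamma t) + v (gamma t)) =
     F1 t (u t) (u (gamma t)) + F2 t (v t) (v (gamma t))) ->
  is_sol F3 (fun t => u t + v t).
Proof.
move=> [cu du dru dlu] [cv dv drv dlv] F123; split.
- exact: continuous_onD.
- by move=> t It tn; rewrite F123//; apply: derivD => //; [exact: du|exact: dv].
- by move=> i Ii; rewrite F123//; apply: derivD => //; [exact: dru|exact: drv].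
- move=> i Ii; have [L1 dL1] := dlu i Ii; have [L2 dL2] := dlv i Ii.
  by exists (L1 + L2); exact: derivD.
Qed.

Lemma is_solutionN F1 F2 u : is_sol F1 u ->
  (forall t, I t -> F2 t (- u t) (- u (gamma t)) = - F1 t (u t) (u (gamma t))) ->
  is_sol F2 (fun t => - u t).
Proof.
move=> [cu du dru dlu] F12; split.
- by move=> t Dt; exact: (nlimN nrmP (cu t Dt)).
- by move=> t It tn; rewrite F12//; apply: derivN => //; exact: du.
- by move=> i Ii; rewrite F12//; apply: derivN => //; exact: dru.
- by move=> i Ii; have [L dL] := dlu i Ii; exists (- L); exact: derivN.
Qed.

(** The fixed-point equation holds on [D] only, so solutions must be transferable along equality on
    [D]. *)
Lemma is_solution_ext F u v : (forall s, D s -> u s = v s) -> is_sol F u -> is_sol F v.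
Proof.
move=> uv [cu du dru dlu].
have near_uv (G : set_system R) (FG : Filter G) t :
    \forall h \near within [set h | I (t + h)] G, u (t + h) = v (t + h).
  by apply: (@filterE _ G) => h /ID; exact: uv.
split.
- exact: continuous_on_ext cu.
- move=> t It tn; rewrite -(uv t (ID It)) -(uv _ (gammaID It)).
  by apply: (deriv_congr nrmP) (du t It tn); [exact: uv (ID It)|exact: near_uv].
- move=> i Ii; rewrite -(uv _ (ID Ii)) -(uv _ (gammaID Ii)).
  by apply: (deriv_congr nrmP) (dru i Ii); [exact: uv (ID Ii)|exact: near_uv].
- move=> i Ii; have [L dL] := dlu i Ii; exists L.
  by apply: (deriv_congr nrmP) dL; [exact: uv (ID Ii)|exact: near_uv].
Qed.

End SolutionAlgebra.

(** * The perturbation operator *)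

Lemma dist_maxl (R : realDomainType) (a s t : R) :
  `|Num.max a s - Num.max a t| <= `|s - t|.
Proof.
wlog st : s t / s <= t => [H|].
  by have [/H//|/ltW/H] := leP s t; rewrite distrC (distrC s).
rewrite distrC (distrC s) !ger0_norm ?subr_ge0//; last by rewrite ge_max !le_max lexx st orbT.
rewrite lerBlDr ge_max; apply/andP; split.
  by rewrite -[leLHS]add0r lerD ?subr_ge0// le_max lexx.
by rewrite -[leLHS](subrK s) lerD2l le_max lexx orbT.
Qed.

Section Perturbation.
Variables (R : realType) (p : nat) (nrm : 'cV[R[i]]_p -> R).
Hypothesis nrmP : is_norm nrm.
Local Notation V := 'cV[R[i]]_p.
Local Notation opn := (opnorm nrm).
Local Notation lim_nrm := (nlim nrm).
Variables (tgrid zeta : int -> R) (gamma : R -> R).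
Hypothesis grid : is_grid tgrid zeta gamma.
Variables (A B X : R -> 'M[R[i]]_p) (Z : R -> R -> 'M[R[i]]_p) (P : 'M[R[i]]_p).
Hypothesis X_fund : is_fundamental_ode tgrid gamma nrm A X.
Hypothesis Z_fund : is_fundamental_pca tgrid gamma nrm A B Z.
Variables (f : R -> V -> V -> V) (eta : R -> R) (t0 : R).
Hypothesis f_cont : jointly_continuous nrm f.
Hypothesis f_lip : hyp_H3_lipschitz nrm f eta.
Hypothesis eta_int : (@lebesgue_measure R).-integrable `[t0, +oo[ (EFin \o eta).
Hypothesis f0_int : integrable_mx `[t0, +oo[ (fun t => f t 0 0).
Variables (M c : R).
Hypothesis M_ge0 : 0 <= M.
Hypothesis c_ge0 : 0 <= c.
Hypothesis X_bound : forall i s t,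
  (tgrid i <= s <= zeta i /\ tgrid i <= t <= zeta i) \/
  (zeta i <= s <= tgrid (i + 1) /\ zeta i <= t <= tgrid (i + 1)) ->
  opn (X t *m invmx (X s)) <= M.
Hypothesis Z_bound : forall t s, t0 <= t -> t0 <= s ->
  opn (dichotomy_kernel Z P t s) <= c.

Variables (i0 : int) (tau : R).
Hypothesis tau_step : tgrid i0 <= tau < tgrid (i0 + 1).
Hypothesis t0_le : t0 <= tgrid i0.
Let T (j : nat) := tgrid (i0 + j%:Z).
Let zt (j : nat) := zeta (i0 + j%:Z).
Hypothesis eta_small : forall n,
  M * (1 + 2 * c) * (4 * \sum_(j < n) step_integral T eta j) <= 1.

Local Notation D := (initial_ray gamma tau).
Let tau' := Num.min tau (gamma tau).
Let U t := Z t 0.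

Let T_lt j : T j < T j.+1. Proof. exact: (steps_lt grid). Qed.
Let zt_itv j : T j <= zt j <= T j.+1. Proof. exact: (steps_zt grid). Qed.
Let T_index t : T 0 <= t -> exists j, T j <= t < T j.+1. Proof. exact: (steps_index grid). Qed.
Let t0T : t0 <= T 0. Proof. by rewrite /T addr0. Qed.
Let U_unit t : U t \in unitmx. Proof. exact: (pca_unit Z_fund t). Qed.
Let X_unit t : X t \in unitmx. Proof. exact: (fundamental_unit X_fund t). Qed.

Let X_step j s t :
  (T j <= s <= zt j /\ T j <= t <= zt j) \/
  (zt j <= s <= T j.+1 /\ zt j <= t <= T j.+1) -> opn (X t *m invmx (X s)) <= M.
Proof. by rewrite /T grid_succ; exact: X_bound. Qed.

Let U_stable s t : T 0 <= s -> s <= t -> opn (U t *m P *m invmx (U s)) <= c.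
Proof.
move=> s0 st; have := @Z_bound t s; rewrite /dichotomy_kernel st (pca_inv Z_fund).
by apply; rewrite (le_trans t0T)// (le_trans s0).
Qed.

Let U_unstable s t : T 0 <= t -> t < s -> opn (U t *m (1%:M - P) *m invmx (U s)) <= c.
Proof.
move=> s0 st; have := @Z_bound t s; rewrite /dichotomy_kernel (leNgt s t) st/=.
rewrite (pca_inv Z_fund) (opnormN nrmP); apply; rewrite (le_trans t0T)//.
by rewrite (le_trans s0)// ltW.
Qed.

Let D_tau' s : D s <-> tau' <= s.
Proof. by rewrite /initial_ray/= in_itv/= andbT. Qed.

Let D_neq0 : D !=set0. Proof. by exists tau'; apply/D_tau'. Qed.

Let D_ge s : D s -> T 0 <= s. Proof. exact: (ray_ge grid tau_step). Qed.

Let I_D : `[tau, +oo[ `<=` D.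
Proof. by move=> t /=; rewrite in_itv/= andbT => /ray_tau. Qed.

Let gamma_D t : `[tau, +oo[%classic t -> D (gamma t).
Proof. by rewrite /= in_itv/= andbT; exact: (ray_gamma grid tau_step). Qed.

(* Extended to the left by a constant, [v] is defined and continuous on the line. *)
Let ext (v : R -> V) s := v (Num.max tau' s).

Let ext_D v s : D s -> ext v s = v s.
Proof. by move=> /D_tau' ts; rewrite /ext max_r. Qed.

Let D_max s : D (Num.max tau' s).
Proof. by apply/D_tau'; rewrite le_max lexx. Qed.

(** The delayed argument is frozen at [zt j], its value on step [j]. The forcing is then continuous
    on the whole line, although [gamma] jumps at grid points. *)
Let forcing (v : R -> V) (j : nat) s : V := f s (ext v s) (ext v (zt j)).

Local Notation admissible := (bounded_continuous nrm D).

Let ext_lim v t : continuous_on nrm D v -> lim_nrm (nbhs t) (ext v) (ext v t).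
Proof.
move=> cv; have := cv _ (D_max t).
suff mx : (fun s => Num.max tau' s) @ nbhs t --> within D (nbhs (Num.max tau' t)).
  by move=> /(cvg_comp _ _ mx).
move=> E /nbhs_ballP[e /= e0 He]; apply/nbhs_ballP; exists e => //= s ts.
by apply: He => //; apply: le_lt_trans ts; exact: dist_maxl.
Qed.

Let forcing_lim v j t : continuous_on nrm D v ->
  lim_nrm (nbhs t) (forcing v j) (forcing v j t).
Proof.
move=> cv; apply/cvgr0Pnorm_lt => e e0.
have [d d0 Hd] := f_cont t (ext v t) (ext v (zt j)) e0.
near=> s; rewrite ger0_norm ?nrm_ge0//; apply: Hd.
- near: s; apply/nbhs_ballP; exists d => //= s; rewrite /ball/= distrC; exact.
- apply: le_lt_trans (ler_norm _) _; near: s.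
  exact: (cvgr0_norm_lt _ (ext_lim t cv) _ d0).
- by rewrite subrr nrm0.
Unshelve. all: by end_near. Qed.

Let forcing_cont v j t : continuous_on nrm D v ->
  lim_nrm (nbhs t) (fun s => invmx (X s) *m forcing v j s) (invmx (X t) *m forcing v j t).
Proof.
move=> cv; apply: nlim_mulmx => //; last exact: forcing_lim.
by apply: invmx_lim => //; exact: (fundamental_lim nrmP X_fund t).
Qed.

Let K1 := \sum_(i < p) nrm (delta_mx i 0).

(** The hypothesis on [f t 0 0] is entrywise, so this multiple of the sum of the entries serves as
    its integrable majorant. *)
Let f0_bound s := K1 *
  \sum_i \sum_j (`|complex.Re (f s 0 0 i j)| + `|complex.Im (f s 0 0 i j)|).

Let f0_bound_ge s : nrm (f s 0 0) <= f0_bound s.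
Proof.
apply: le_trans (nrm_le_l1 nrmP _) _; rewrite le_eqVlt; apply/orP; left; apply/eqP.
by congr (_ * _); apply: eq_bigr => i _; rewrite big_ord1.
Qed.

Let f0_bound_int : (@lebesgue_measure R).-integrable `[t0, +oo[ (EFin \o f0_bound).
Proof.
have mI : measurable (`[t0, +oo[%classic : set (measurableTypeR R)) by exact: measurable_itv.
have := integrableZl mI K1 (integrable_entries mI f0_int).
by apply: eq_integrable => // s _; rewrite /= /f0_bound EFinM.
Qed.

Let eta_ge0 s : 0 <= eta s. Proof. by case: f_lip. Qed.

Let f_lipE t x1 y1 x2 y2 :
  nrm (f t x1 y1 - f t x2 y2) <= eta t * (nrm (x1 - x2) + nrm (y1 - y2)).
Proof. by case: f_lip. Qed.

(** The Lipschitz condition compares the forcing with [f s 0 0]. Integrability of [eta] and of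
    [f t 0 0] makes the step integrals summable. *)
Let forcing_bound v (K : R) : (forall s, D s -> nrm (v s) <= K) ->
  exists phi S, [/\ step_bound nrm T (forcing v) phi (step_integral T phi) &
    forall n, \sum_(j < n) step_integral T phi j <= S].
Proof.
move=> HK.
have K0 : 0 <= K by case: D_neq0 => s Ds; rewrite (le_trans _ (HK s Ds))// nrm_ge0.
pose phi s := eta s * (K + K) + f0_bound s.
have phi0 s : 0 <= phi s.
  apply: addr_ge0; first by rewrite mulr_ge0 ?addr_ge0.
  exact: le_trans (nrm_ge0 nrmP _) (f0_bound_ge s).
have phi_int : (@lebesgue_measure R).-integrable `[t0, +oo[ (EFin \o phi).
  have mI : measurable (`[t0, +oo[%classic : set (measurableTypeR R)) by exact: measurable_itv.
  have := integrableD mI (integrableZl mI (K + K) eta_int) f0_bound_int.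
  apply: eq_integrable => // s _; by rewrite /= /phi -EFinM -EFinD (mulrC (eta s)).
exists phi, (\int[@lebesgue_measure R]_(s in `[t0, +oo[) phi s); split; last first.
  by move=> n; exact: (sum_step_integral T_lt t0T phi_int).
move=> j; split.
- exact: (step_integral_measurable T_lt t0T phi_int).
- move=> s _; rewrite /forcing -(subrK (f s 0 0) (f s _ _)).
  rewrite (le_trans (nrmD nrmP _ _))// lerD//.
  apply: (le_trans (f_lipE _ _ _ _ _)); rewrite !subr0 ler_wpM2l//.
  by rewrite lerD// HK//; exact: D_max.
- by rewrite (step_integralE T_lt t0T phi_int).
Qed.

Let perturbation_rel v w := exists Q L, step_solution nrm T zt X U P (forcing v) Q L w.

Let perturbation_exists v : admissible v -> exists w, perturbation_rel v w.
Proof.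
move=> [cv [K /forcing_bound[phi [S [hE ES]]]]].
have [Q [L [w Hw]]] := step_solution_exists nrmP T_lt zt_itv T_index U_unit M_ge0 c_ge0
  X_step U_unstable hE ES (fun j t => forcing_cont j t cv).
by exists w, Q, L.
Qed.

Let perturbation_bounded v w : admissible v -> perturbation_rel v w -> bounded_on nrm D w.
Proof.
move=> [cv [K /forcing_bound[phi [S [hE ES]]]]] [Q [L Hw]].
exists (M * (1 + 2 * c) * S) => s /D_ge s0.
exact: (step_solution_bound nrmP T_lt zt_itv T_index M_ge0 c_ge0 X_step
  U_stable U_unstable hE ES Hw s0).
Qed.

Let perturbation_contract v v' w w' (d : R) : (forall s, D s -> nrm (v s - v' s) <= d) ->
  perturbation_rel v w -> perturbation_rel v' w' ->
  forall s, D s -> nrm (w s - w' s) <= d / 2.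
Proof.
move=> vd [Q [L Hw]] [Q' [L' Hw']] s /D_ge s0.
have d0 : 0 <= d by case: D_neq0 => r Dr; rewrite (le_trans _ (vd r Dr))// nrm_ge0.
have Hd := step_solutionB nrmP Hw Hw'.
pose phi s := eta s * (d + d).
have phi0 r : 0 <= phi r by rewrite mulr_ge0// addr_ge0.
have phi_int : (@lebesgue_measure R).-integrable `[t0, +oo[ (EFin \o phi).
  have mI : measurable (`[t0, +oo[%classic : set (measurableTypeR R)) by exact: measurable_itv.
  have := integrableZl mI (d + d) eta_int.
  by apply: eq_integrable => // r _; rewrite /= /phi EFinM muleC.
have phiE j : step_integral T phi j = step_integral T eta j * (d + d).
  apply: RintegralZr => //.
  apply: integrableS eta_int => //.
  move=> r /=; rewrite !in_itv/= andbT => /andP[/ltW h _].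
  by rewrite (le_trans _ h)// (le_trans t0T)// (T_le T_lt).
have hE : step_bound nrm T (fun j t => forcing v j t - forcing v' j t) phi
    (step_integral T phi).
  move=> j; split.
  - exact: (step_integral_measurable T_lt t0T phi_int).
  - move=> r _; rewrite /forcing; apply: (le_trans (f_lipE _ _ _ _ _)).
    by rewrite /phi ler_wpM2l// lerD// vd//; exact: D_max.
  - by rewrite (step_integralE T_lt t0T phi_int).
have MC : 0 <= M * (1 + 2 * c) by rewrite mulr_ge0// addr_ge0// mulr_ge0.
have [C0|C0] := eqVneq (M * (1 + 2 * c)) 0.
  have := step_solution_bound nrmP T_lt zt_itv T_index M_ge0 c_ge0 X_step
    U_stable U_unstable hE (sum_step_integral T_lt t0T phi_int phi0) Hd s0.
  by rewrite C0 mul0r => /le_trans; apply; rewrite divr_ge0.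
have Cp : 0 < M * (1 + 2 * c) by rewrite lt_neqAle eq_sym C0.
(* Each of the two arguments of [f] differs by at most [d], so the forcing contributes [2 * d] times
   the integral of [eta]; the factor 4 in [eta_small] leaves [d / 2]. *)
have ES n : \sum_(j < n) step_integral T phi j <= d / 2 / (M * (1 + 2 * c)).
  under eq_bigr do rewrite phiE.
  rewrite -mulr_suml ler_pdivlMr//.
  have := ler_wpM2r d0 (eta_small n); rewrite mul1r.
  set E := \sum_(j < n) _; rewrite mulrA.
  move: (M * (1 + 2 * c)) => C; lra.
have := step_solution_bound nrmP T_lt zt_itv T_index M_ge0 c_ge0 X_step
    U_stable U_unstable hE ES Hd s0.
by rewrite mulrC divfK.
Qed.

Let perturbation_solution v w : perturbation_rel v w ->
  is_solution tgrid gamma nrm D `[tau, +oo[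
    (affine_rhs A B (fun t => f t (v t) (v (gamma t)))) w.
Proof.
move=> [Q [L Hw]].
apply: (step_solution_is_solution nrmP grid X_fund Z_fund tau_step Hw) => j t tj tt.
have Dt : D t by exact: ray_tau.
have Dg : D (gamma t) by apply: gamma_D; rewrite /= in_itv/= andbT.
rewrite /forcing (_ : zt j = gamma t) ?ext_D//.
exact/esym/(steps_gamma grid tj).
Qed.

Let perturbation_vanishes v w : admissible v -> perturbation_rel v w ->
  (fun t => opn (Z t 0 *m P)) @ +oo --> (0 : R) ->
  (fun t => nrm (w t)) @ +oo --> (0 : R).
Proof.
move=> [cv [K /forcing_bound[phi [S [hE ES]]]]] [Q [L Hw]].
exact: (step_solution_vanishes nrmP T_lt zt_itv T_index M_ge0 c_ge0 X_step
  U_stable U_unstable hE ES Hw).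
Qed.

(* The operator [v |-> y - v] of the correspondence: a particular solution forced
   by [f] along [v]. *)
Lemma perturbation_operator : exists W : (R -> V) -> R -> V,
  [/\ forall v, admissible v -> is_solution tgrid gamma nrm D `[tau, +oo[
        (affine_rhs A B (fun t => f t (v t) (v (gamma t)))) (W v),
      forall v, admissible v -> admissible (W v),
      forall v v' (d : R), admissible v -> admissible v' ->
        (forall s, D s -> nrm (v s - v' s) <= d) ->
        forall s, D s -> nrm (W v s - W v' s) <= d / 2 &
      (fun t => opn (Z t 0 *m P)) @ +oo --> (0 : R) ->
      forall v, admissible v -> (fun t => nrm (W v t)) @ +oo --> (0 : R)].
Proof.
have /choice[W HW] : forall v, exists w, admissible v -> perturbation_rel v w.
  move=> v; have [/perturbation_exists[w vw]|nv] := pselect (admissible v).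
    by exists w.
  by exists v => /nv.
exists W; split=> [v /HW/perturbation_solution //|v av|v v' d av av' vd|ZP v av].
- split; last exact: perturbation_bounded av (HW v av).
  exact: solution_cont (perturbation_solution (HW v av)).
- exact: perturbation_contract vd (HW v av) (HW v' av').
- exact: perturbation_vanishes av (HW v av) ZP.
Qed.

End Perturbation.

(** * The correspondence *)

Section HalfContraction.
Variables (R : realType) (p : nat) (nrm : 'cV[R[i]]_p -> R).
Hypothesis nrmP : is_norm nrm.
Local Notation V := 'cV[R[i]]_p.
Variable D : set R.
Hypothesis D_neq0 : D !=set0.
Local Notation admissible := (bounded_continuous nrm D).
Variable W : (R -> V) -> R -> V.
Hypothesis W_admissible : forall v, admissible v -> admissible (W v).
Hypothesis W_half : forall v v' (d : R), admissible v -> admissible v' ->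
  (forall s, D s -> nrm (v s - v' s) <= d) ->
  forall s, D s -> nrm (W v s - W v' s) <= d / 2.

(** Picard iteration of [u |-> y + W u] from [y], pointwise on [D] with bounds uniform in [s]; the
    uniform limit is again bounded and continuous. *)
Lemma half_contraction_fixed_point y : admissible y ->
  exists2 v, admissible v & forall s, D s -> v s = y s + W v s.
Proof.
move=> ya; pose v n := iter n (fun u s => y s + W u s) y.
have addW u : admissible u -> admissible (fun s => y s + W u s).
  move=> /W_admissible[cW bW]; case: (ya) => cy by_.
  by split; [exact: continuous_onD|exact: bounded_onD].
have va n : admissible (v n) by elim: n => [//|n IH]; exact: addW.
have [_ [K HK]] := W_admissible ya.
(* [K] bounds the first increment [W y], hence [K / 2 ^ n] the [n]-th one; twice that, [a n],
   dominates the whole remaining tail. *)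
have K0 : 0 <= K by case: D_neq0 => s Ds; rewrite (le_trans _ (HK s Ds))// nrm_ge0.
pose a n : R := geometric (2 * K) 2^-1 n.
have aE n : a n = 2 * K * 2^-1 ^+ n by [].
have a_ge0 n : 0 <= a n by rewrite aE !mulr_ge0.
have aS n : a n.+1 = a n / 2 by rewrite !aE exprSr mulrA.
have a0 : a @ \oo --> (0 : R) by apply: cvg_geometric; rewrite ger0_norm//; lra.
have small (e : R) : 0 < e -> exists n, a n <= e.
  move=> e0; have [N _ HN] := cvgr0_norm_le _ a0 _ e0.
  by exists N; rewrite (le_trans (ler_norm _))// (HN N (leqnn N)).
have step n s : D s -> nrm (v n.+1 s - v n s) <= a n / 2.
  elim: n s => [|n IH] s Ds.
    by rewrite /= addrAC subrr add0r aE expr0 mulr1 mulrAC mulfV// mul1r; exact: HK.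
  have -> : v n.+2 s - v n.+1 s = W (v n.+1) s - W (v n) s.
    by rewrite /= opprD addrACA subrr add0r.
  by rewrite aS; apply: W_half.
have tail s n k : D s -> nrm (v (n + k)%N s - v n s) <= a n - a (n + k)%N.
  move=> Ds; elim: k => [|k IH]; first by rewrite addn0 !subrr nrm0.
  rewrite addnS; have := nrm_distD nrmP (v (n + k)%N s) (v (n + k).+1 s) (v n s).
  by have := step (n + k)%N s Ds; rewrite aS; move: IH; lra.
have /choice[u Hu] : forall s, exists l, D s -> forall n, nrm (l - v n s) <= a n.
  move=> s; have [Ds|nD] := pselect (D s); last by exists 0 => /nD.
  have [l _ Hl] : exists2 l, nlim nrm \oo (fun n => v n s) l &
      forall n, nrm (l - v n s) <= a n.
    apply: cauchy_nlim => // n m nm; rewrite -(subnKC nm).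
    by apply: (le_trans (tail s n (m - n)%N Ds)); rewrite gerBl.
  by exists l.
have ua : admissible u.
  split.
    apply: (continuous_on_uniform_limit nrmP) => e /small[n ne].
    by exists (v n) => [|s Ds]; [case: (va n)|rewrite (le_trans (Hu s Ds n))].
  case: (ya) => _ [Ky HKy]; exists (a 0 + Ky) => s Ds.
  rewrite -(subrK (v 0%N s) (u s)) (le_trans (nrmD nrmP _ _))// lerD//.
    exact: Hu.
  exact: HKy.
exists u => // s Ds; apply/eqP; rewrite -subr_eq0; apply/eqP.
apply: (is_norm_eq0 nrmP); apply/eqP; rewrite eq_le nrm_ge0// andbT.
apply/ler_addgt0Pr => e /small[n ne]; rewrite add0r; apply: le_trans ne.
apply: le_trans (nrm_distD nrmP (v n.+1 s) _ _) _.
have := Hu s Ds n.+1; rewrite aS.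
have -> : v n.+1 s - (y s + W u s) = W (v n) s - W u s.
  by rewrite /= opprD addrACA subrr add0r.
have : nrm (W (v n) s - W u s) <= a n / 2.
  by apply: W_half => // r Dr; rewrite nrm_distC// Hu.
lra.
Qed.

(** The supremum of [v - v'] is finite and at most [d] plus half of itself. The case [d = 0] is
    uniqueness of the fixed point, the general case continuity of the correspondence. *)
Lemma half_contraction_stable y y' v v' (d : R) : admissible v -> admissible v' ->
  (forall s, D s -> v s = y s + W v s) -> (forall s, D s -> v' s = y' s + W v' s) ->
  (forall s, D s -> nrm (y s - y' s) <= d) ->
  forall s, D s -> nrm (v s - v' s) <= 2 * d.
Proof.
move=> va va' vE vE' yd s Ds.
have bd : bounded_on nrm D (fun s => v s - v' s).
  by apply: bounded_onB => //; [case: va|case: va'].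
have sd r : D r -> nrm (v r - v' r) <= supnorm nrm D (fun s => v s - v' s).
  exact: (le_supnorm bd).
have : supnorm nrm D (fun s => v s - v' s) <= d + supnorm nrm D (fun s => v s - v' s) / 2.
  apply: (supnorm_le D_neq0) => r Dr; rewrite (vE r Dr) (vE' r Dr) opprD addrACA.
  by rewrite (le_trans (nrmD nrmP _ _))// lerD ?yd//; apply: W_half.
by have := sd s Ds; lra.
Qed.

End HalfContraction.

Section Correspondence.
Variables (R : realType) (p : nat) (nrm : 'cV[R[i]]_p -> R).
Hypothesis nrmP : is_norm nrm.
Local Notation V := 'cV[R[i]]_p.
Variables (tgrid : int -> R) (gamma : R -> R) (A B : R -> 'M[R[i]]_p).
Variables (g : R -> V) (f : R -> V -> V -> V) (tau : R).
Local Notation D := (initial_ray gamma tau).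
Hypothesis ray_gamma : forall t, tau <= t -> D (gamma t).
Local Notation admissible := (bounded_continuous nrm D).
Variable W : (R -> V) -> R -> V.
Hypothesis W_sol : forall v, admissible v -> is_solution tgrid gamma nrm D `[tau, +oo[
  (affine_rhs A B (fun t => f t (v t) (v (gamma t)))) (W v).
Hypothesis W_admissible : forall v, admissible v -> admissible (W v).
Hypothesis W_half : forall v v' (d : R), admissible v -> admissible v' ->
  (forall s, D s -> nrm (v s - v' s) <= d) ->
  forall s, D s -> nrm (W v s - W v' s) <= d / 2.
Local Notation linear_sols := (bounded_solutions tgrid gamma nrm tau (affine_rhs A B g)).
Local Notation quasilinear_sols :=
  (bounded_solutions tgrid gamma nrm tau (quasilinear_rhs A B g f)).

Let I_D : `[tau, +oo[ `<=` D.
Proof. by move=> t /=; rewrite in_itv/= andbT => /ray_tau. Qed.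

Let gamma_D t : `[tau, +oo[%classic t -> D (gamma t).
Proof. by rewrite /= in_itv/= andbT; exact: ray_gamma. Qed.

Let D_neq0 : D !=set0.
Proof. by exists tau; apply: ray_tau. Qed.

Lemma bounded_solution_admissible F v :
  bounded_solutions tgrid gamma nrm tau F v -> admissible v.
Proof. by move=> [[cv _ _ _] bv _]. Qed.

Lemma bounded_solution_eq F G u v : bounded_solutions tgrid gamma nrm tau F u ->
  bounded_solutions tgrid gamma nrm tau G v -> (forall s, D s -> u s = v s) -> u = v.
Proof.
move=> [_ _ u0] [_ _ v0] uv; apply/funext => s.
by have [/uv//|nD] := pselect (D s); rewrite u0// v0.
Qed.

Lemma quasilinear_of_linear y v : linear_sols y -> admissible v ->
  (forall s, D s -> v s = y s + W v s) -> (forall s, ~ D s -> v s = 0) ->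
  quasilinear_sols v.
Proof.
move=> ys va vE v0; split=> //; last by case: va.
have [sy _ _] := ys.
apply: (is_solution_ext nrmP I_D gamma_D (u := fun s => y s + W v s)).
  by move=> s /vE.
apply: (is_solutionD nrmP sy (W_sol va)) => t It.
rewrite /quasilinear_rhs /affine_rhs -(vE _ (I_D It)) -(vE _ (gamma_D It)).
rewrite [in A t *m v t](vE _ (I_D It)) [in B t *m v _](vE _ (gamma_D It)) !mulmxDr.
by rewrite (addrACA (A t *m y t)) [X in X + _ = _]addrAC [RHS]addrA.
Qed.

Lemma linear_of_quasilinear v : quasilinear_sols v ->
  exists2 y, linear_sols y & forall s, D s -> v s = y s + W v s.
Proof.
move=> vs; have va := bounded_solution_admissible vs; have [sv bv v0] := vs.
pose y s := if pselect (D s) then v s - W v s else 0.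
have yE s : D s -> y s = v s - W v s by rewrite /y; case: pselect.
exists y; last by move=> s Ds; rewrite yE// subrK.
have [_ bW] := W_admissible va.
split; last by move=> s; rewrite /y; case: pselect.
- apply: (is_solution_ext nrmP I_D gamma_D (u := fun s => v s + - W v s)).
    by move=> s /yE.
  have := is_solutionN nrmP (F2 := affine_rhs A B (fun t => - f t (v t) (v (gamma t))))
    (W_sol va).
  move=> /(_ _)/(is_solutionD nrmP sv); apply.
    by move=> t It; rewrite /affine_rhs !mulmxN -!opprD.
  move=> t It; rewrite /quasilinear_rhs /affine_rhs !mulmxDr !mulmxN.
  by rewrite [RHS]addrACA subrr addr0 (addrACA (A t *m v t)) [LHS]addrAC.
- apply: (bounded_on_ext (u := fun s => v s - W v s)); last exact: bounded_onB.
  by move=> s /yE.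
Qed.

(** [H y] is the fixed point of [v |-> y + W v], set to 0 off the ray. It is Lipschitz with constant
    2, and its inverse [v |-> v - W v] with constant 3/2. *)
Lemma correspondence : exists H : (R -> V) -> (R -> V),
  [/\ is_homeo nrm D linear_sols quasilinear_sols H,
      forall y, linear_sols y -> admissible (H y) &
      forall y, linear_sols y -> forall s, D s -> H y s = y s + W (H y) s].
Proof.
have /choice[H HH] : forall y, exists v, linear_sols y ->
    [/\ admissible v, forall s, D s -> v s = y s + W v s & forall s, ~ D s -> v s = 0].
  move=> y; have [ys|nys] := pselect (linear_sols y); last by exists y => /nys.
  have [v [cv bv] vE] := half_contraction_fixed_point nrmP D_neq0 W_admissible W_half
    (bounded_solution_admissible ys).
  pose u s := if pselect (D s) then v s else 0.
  have uE s : D s -> u s = v s by rewrite /u; case: pselect.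
  have ua : admissible u.
    split; first by apply: (continuous_on_ext nrmP) cv => s /uE.
    by apply: bounded_on_ext bv => s /uE.
  exists u => _; split=> // [s Ds|s]; last by rewrite /u; case: pselect.
  (* Truncation changes the function only off [D]; [W_half] with [d = 0] shows that its image under
     [W] is the same on [D]. *)
  rewrite uE// vE//; congr (_ + _); apply/eqP; rewrite -subr_eq0; apply/eqP.
  apply: (is_norm_eq0 nrmP); apply/eqP; rewrite eq_le nrm_ge0// andbT.
  rewrite -(mul0r 2^-1); apply: (W_half (conj cv bv) ua) => // r Dr.
  by rewrite uE// subrr nrm0.
have Hs y : linear_sols y -> quasilinear_sols (H y).
  by move=> ys; have [va vE v0] := HH y ys; exact: quasilinear_of_linear ys va vE v0.
have stable y y' (d : R) : linear_sols y -> linear_sols y' ->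
    (forall s, D s -> nrm (y s - y' s) <= d) ->
    forall s, D s -> nrm (H y s - H y' s) <= 2 * d.
  move=> /HH[va vE _] /HH[va' vE' _].
  exact: (half_contraction_stable nrmP D_neq0 W_half va va' vE vE').
have bB F G u v : bounded_solutions tgrid gamma nrm tau F u ->
    bounded_solutions tgrid gamma nrm tau G v -> bounded_on nrm D (u \- v).
  move=> /bounded_solution_admissible[_ bu] /bounded_solution_admissible[_ bv].
  exact: bounded_onB.
exists H; split; last 2 first.
- by move=> y /HH[].
- by move=> y /HH[].
split.
- split=> [y /Hs//|y y' /set_mem ys /set_mem ys' Hyy'|v vs].
    apply: (bounded_solution_eq ys ys') => s Ds.
    have [_ vE _] := HH y ys; have [_ vE' _] := HH y' ys'.
    by apply: (addIr (W (H y) s)); rewrite -vE// Hyy' vE'.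
  have [y ys vE] := linear_of_quasilinear vs; exists y => //.
  have [va' vE' _] := HH y ys.
  apply: (bounded_solution_eq (Hs y ys) vs) => s Ds.
  apply/eqP; rewrite -subr_eq0; apply/eqP; apply: (is_norm_eq0 nrmP).
  apply/eqP; rewrite eq_le nrm_ge0// andbT -(mulr0 2).
  apply: (half_contraction_stable nrmP D_neq0 W_half va' (bounded_solution_admissible vs)
    vE' vE) => // r Dr.
  by rewrite subrr nrm0.
- move=> y ys e e0; exists (e / 2); first by rewrite divr_gt0.
  move=> y' ys' yd; apply: le_lt_trans (_ : 2 * supnorm nrm D (y' \- y) < e).
    apply: (supnorm_le D_neq0) => s; apply: stable => // r Dr.
    exact: (le_supnorm (bB _ _ _ _ ys' ys)).
  by move: yd; lra.
- move=> y ys e e0; exists (e / 2); first by rewrite divr_gt0.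
  move=> y' ys' yd; have [va vE _] := HH y ys; have [va' vE' _] := HH y' ys'.
  set S := supnorm nrm D (H y' \- H y) in yd.
  have HS r : D r -> nrm (H y' r - H y r) <= S.
    exact: (le_supnorm (bB _ _ _ _ (Hs _ ys') (Hs _ ys))).
  apply: le_lt_trans (_ : S + S / 2 < e).
    apply: (supnorm_le D_neq0) => s Ds.
    have -> : (y' \- y) s = (H y' s - H y s) - (W (H y') s - W (H y) s).
      by rewrite (vE' s Ds) (vE s Ds) opprD addrACA addrK.
    rewrite (le_trans (nrmB nrmP _ _))// lerD ?HS//.
    exact: (W_half va' va HS).
  have S0 : 0 <= S.
    by case: D_neq0 => r Dr; rewrite (le_trans _ (HS r Dr))// nrm_ge0.
  by move: yd S0; lra.
Qed.

End Correspondence.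

(** Once a partial sum is within [e] of the supremum of all partial sums, every later block is below
    [e]. Uniformity in the offset [n] lets a single [i0] serve all later initial times. *)
Lemma grid_tail_small (R : realType) (tgrid zeta : int -> R) (gamma : R -> R)
    (t0 : R) (eta : R -> R) (e : R) : is_grid tgrid zeta gamma ->
  (forall s, 0 <= eta s) -> (@lebesgue_measure R).-integrable `[t0, +oo[ (EFin \o eta) ->
  0 < e -> exists2 i0, t0 <= tgrid i0 & forall (n k : nat),
    \sum_(j < k) step_integral (fun j => tgrid (i0 + n%:Z + j%:Z)) eta j <= e.
Proof.
move=> grid eta0 eta_int e0.
have [b tb] : exists b : nat, t0 <= tgrid b%:Z.
  have /cvgryPge/(_ t0)[N _ HN] := grid_pinfty grid.
  by exists N; exact: (HN N (leqnn N)).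
pose Tb (j : nat) := tgrid (b%:Z + j%:Z).
have Tb_lt j : Tb j < Tb j.+1 by exact: (steps_lt grid).
have tb0 : t0 <= Tb 0 by rewrite /Tb addr0.
pose S n := \sum_(j < n) step_integral Tb eta j.
have Sub : has_ubound (range S).
  by exists (\int[@lebesgue_measure R]_(s in `[t0, +oo[) eta s) => _ [n _ <-];
    exact: (sum_step_integral Tb_lt tb0 eta_int eta0).
have S_homo : {homo S : n m / (n <= m)%N >-> n <= m}.
  move=> n m nm; rewrite /S -!(big_mkord xpredT (step_integral Tb eta)).
  rewrite (big_cat_nat (leq0n _) nm)//= lerDl sumr_ge0// => j _.
  exact: (step_integral_ge0 Tb_lt tb0 eta_int eta0).
have supS : has_sup (range S) by split => //; exists (S 0), 0%N.
have [_ [m _ <-] Sm] := sup_adherent e0 supS.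
exists (b%:Z + m%:Z); first exact: le_trans tb0 (T_le Tb_lt (leq0n m)).
move=> n k.
have -> : \sum_(j < k) step_integral (fun j => tgrid (b%:Z + m%:Z + n%:Z + j%:Z)) eta j =
    S (m + n + k)%N - S (m + n)%N.
  rewrite /S -!(big_mkord xpredT (step_integral Tb eta)).
  rewrite (big_cat_nat (leq0n _) (leq_addr k (m + n)%N))/= [RHS]addrAC subrr add0r.
  rewrite -{1}[(m + n)%N]add0n big_addn addKn big_mkord; apply: eq_bigr => j _.
  rewrite /step_integral /Tb.
  have -> : b%:Z + m%:Z + n%:Z + (j : nat)%:Z = b%:Z + (j + (m + n))%N%:Z by lia.
  by have -> : b%:Z + m%:Z + n%:Z + j.+1%:Z = b%:Z + (j + (m + n)).+1%:Z by lia.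
have : S (m + n + k)%N <= sup (range S) by apply: ub_le_sup => //; exists (m + n + k)%N.
have := S_homo m (m + n)%N (leq_addr _ _); move: Sm; lra.
Qed.

Theorem theorem5p1 (R : realType) (p : nat) (nrm : 'cV[R[i]]_p -> R)
  (tgrid zeta : int -> R) (gamma : R -> R) (t0 : R)
  (A B X : R -> 'M[R[i]]_p) (Z : R -> R -> 'M[R[i]]_p) (P : 'M[R[i]]_p)
  (g : R -> 'cV[R[i]]_p) (f : R -> 'cV[R[i]]_p -> 'cV[R[i]]_p -> 'cV[R[i]]_p)
  (eta : R -> R)
  (norm_nrm : is_norm nrm)
  (grid : is_grid tgrid zeta gamma)
  (H1 : hyp_H1 A B g)
  (H2 : hyp_H2 tgrid zeta nrm A B)
  (H3i : jointly_continuous nrm f)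
  (H3iii : hyp_H3_lipschitz nrm f eta)
  (X_fund : is_fundamental_ode tgrid gamma nrm A X)
  (H4 : hyp_H4 tgrid X B)
  (Z_fund : is_fundamental_pca tgrid gamma nrm A B Z)
  (eta_L1 : (@lebesgue_measure R).-integrable `[t0, +oo[ (EFin \o eta))
  (f0_L1 : integrable_mx `[t0, +oo[ (fun t => f t 0 0))
  (dich : ordinary_dichotomy nrm Z P t0) :
  exists2 T : R, t0 <= T & forall tau : R, T <= tau ->
    exists H : (R -> 'cV[R[i]]_p) -> (R -> 'cV[R[i]]_p),
      is_homeo nrm (initial_ray gamma tau)
        (bounded_solutions tgrid gamma nrm tau (affine_rhs A B g))
        (bounded_solutions tgrid gamma nrm tau (quasilinear_rhs A B g f)) H /\
      ((fun t => opnorm nrm (Z t 0 *m P)) @ +oo --> (0 : R) ->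
       forall y, bounded_solutions tgrid gamma nrm tau (affine_rhs A B g) y ->
         (fun t => nrm (y t - H y t)) @ +oo --> (0 : R)).
Proof.
have [A_int _ _] := H1; have [rhoA _ _] := H2; have [_ [c c0 Zc]] := dich.
have [M [M1 XM]] := transition_le norm_nrm grid X_fund A_int rhoA.
have M0 : 0 < M by rewrite (lt_le_trans ltr01).
have C0 : 0 < M * (1 + 2 * c) * 4 by rewrite !mulr_gt0// addr_gt0// mulr_gt0.
have eta0 s : 0 <= eta s by case: H3iii.
(* The threshold [1 / (4 * M * (1 + 2 * c))] is the one that makes [W] halve distances; it decides
   how far to the right the initial time must lie. *)
have [i0 t0i0 small] := grid_tail_small grid eta0 eta_L1 (divr_gt0 ltr01 C0).
exists (tgrid i0) => // tau /(grid_step grid)[n].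
have -> : i0 + n.+1%:Z = i0 + n%:Z + 1 by lia.
move=> tau_step.
have eta_small k : M * (1 + 2 * c) *
    (4 * \sum_(j < k) step_integral (fun j => tgrid (i0 + n%:Z + j%:Z)) eta j) <= 1.
  by rewrite mulrA mulrC -ler_pdivlMr// small.
have [W [W_sol W_adm W_half W0]] := perturbation_operator norm_nrm grid X_fund Z_fund
  H3i H3iii eta_L1 f0_L1 (ltW M0) (ltW c0) XM Zc tau_step
  (le_trans t0i0 (grid_addn grid i0 n)) eta_small.
have [H [homeo Ha HE]] := correspondence norm_nrm g (ray_gamma grid tau_step)
  W_sol W_adm W_half.
exists H; split=> // ZP y ys.
apply: cvg_trans (W0 ZP _ (Ha y ys)); apply: near_eq_cvg; near=> t.
have tt : initial_ray gamma tau t.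
  by apply: ray_tau; near: t; apply: nbhs_pinfty_ge; rewrite num_real.
by rewrite (HE y ys t tt) opprD addrA subrr sub0r nrmN.
Unshelve. all: by end_near. Qed.
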